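(* Let $n,m$ be positive integers with $n-1\le m\le 2n-2$, and let $\mathcal{H}_{n,m}$ be the set of connected simple graphs with $n$ vertices and $m$ edges. (i) If $\alpha\in(\frac12,1)$, or if $\alpha=\frac12$ and $m\neq n+2$, then $S_{n,m}$ is the only graph in $\mathcal{H}_{n,m}$ maximizing the $A_\alpha$-spectral radius. (ii) If $m=n+2$ and $\alpha=\frac12$, then $S_{n,n+2}$ and $\tilde S_{n,n+2}$ are all the graphs in $\mathcal{H}_{n,n+2}$ maximizing the $A_{1/2}$-spectral radius.
   Context: All graphs are finite, simple, undirected. For a graph $G$ with adjacency matrix $A(G)$ and degree matrix $D(G)$, and $\alpha\in[0,1)$, $A_\alpha(G)=\alpha D(G)+(1-\alpha)A(G)$ and its largest eigenvalue $\rho_\alpha(G)$ is the $A_\alpha$-spectral radius. $\cup$ denotes disjoint union, $\vee$ the join; $K_t$ complete graph, $K_{1,a}$ star with $a$ leaves ($K_{1,0}$ a single vertex), $tK_1$ is $t$ isolated vertices. For $m\ge n-1$, let $k$ be the largest integer with $m\ge\sum_{i=1}^k(n-i)$ and $a=m-\sum_{i=1}^k(n-i)$; $S_{n,m}=K_k\vee(K_{1,a}\cup(n-a-k-1)K_1)$. Also $\tilde S_{n,n+2}=K_1\vee(K_3\cup(n-4)K_1)$. *)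

(* Defs.v *)
From HB Require Import structures.
From mathcomp Require Import all_boot all_order all_algebra.
From mathcomp Require Import all_classical all_reals.

Set Implicit Arguments.
Unset Strict Implicit.
Unset Printing Implicit Defensive.

Import Order.TTheory GRing.Theory Num.Theory.

Record sgraph := SGraph {
  vertex :> finType;
  adj : rel vertex;
  adj_sym : symmetric adj;
  adj_irr : irreflexive adj }.

Arguments adj {s}.

Definition edges (G : sgraph) : {set {set G}} :=
  [set [set p.1; p.2] | p : G * G & adj p.1 p.2].

Definition degree (G : sgraph) (x : G) : nat := #|[set y | adj x y]|.

Definition connected_graph (G : sgraph) : Prop :=
  forall x y : G, connect adj x y.

Definition graph_iso (G H : sgraph) : Prop :=
  exists2 f : G -> H, bijective f & {mono f : x y / adj x y}.

Section Constructions.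

Definition complete_rel (t : nat) : rel 'I_t := fun x y => x != y.

Fact complete_sym t : symmetric (@complete_rel t).
Proof. by move=> x y; rewrite /complete_rel eq_sym. Qed.

Fact complete_irr t : irreflexive (@complete_rel t).
Proof. by move=> x; rewrite /complete_rel eqxx. Qed.

Definition complete (t : nat) : sgraph :=
  SGraph (@complete_sym t) (@complete_irr t).

Definition edgeless_rel (t : nat) : rel 'I_t := fun _ _ => false.

Fact edgeless_sym t : symmetric (@edgeless_rel t).
Proof. by []. Qed.

Fact edgeless_irr t : irreflexive (@edgeless_rel t).
Proof. by []. Qed.

Definition edgeless (t : nat) : sgraph :=
  SGraph (@edgeless_sym t) (@edgeless_irr t).

(* With [b := false] this is the adjacency of the disjoint union, with
   [b := true] that of the join. *)
Definition sum_rel (b : bool) (G H : sgraph) : rel (G + H)%type :=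
  fun u v => match u, v with
  | inl x, inl y => adj x y
  | inr x, inr y => adj x y
  | _, _ => b
  end.

Fact sum_sym b G H : symmetric (@sum_rel b G H).
Proof. by move=> [x|x] [y|y] //=; rewrite adj_sym. Qed.

Fact sum_irr b G H : irreflexive (@sum_rel b G H).
Proof. by move=> [x|x] /=; rewrite adj_irr. Qed.

Definition gunion (G H : sgraph) : sgraph :=
  SGraph (@sum_sym false G H) (@sum_irr false G H).

Definition gjoin (G H : sgraph) : sgraph :=
  SGraph (@sum_sym true G H) (@sum_irr true G H).

Definition star (a : nat) : sgraph := gjoin (edgeless 1) (edgeless a).

End Constructions.

Definition Ssum (n k : nat) : nat := \sum_(1 <= i < k.+1) (n - i).

(* [k] ranges over [0 .. n-1]: the terms [n - i] are then positive, and without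
   this bound a largest [k] need not exist, the sums being eventually
   decreasing over the integers. *)
Definition Sk (n m : nat) : nat := \max_(k < n | Ssum n k <= m) k.

Definition Sa (n m : nat) : nat := m - Ssum n (Sk n m).

(* No subtraction is truncated as long as [0 < n] and [n - 1 <= m <= n(n-1)/2],
   i.e. as long as some connected graph has [n] vertices and [m] edges. *)
Definition Sgraph (n m : nat) : sgraph :=
  let k := Sk n m in
  let a := Sa n m in
  gjoin (complete k) (gunion (star a) (edgeless (n - a - k - 1))).

Definition Stilde (n : nat) : sgraph :=
  gjoin (complete 1) (gunion (complete 3) (edgeless (n - 4))).

Definition inH (n m : nat) (G : sgraph) : Prop :=
  [/\ #|G| = n, #|edges G| = m & connected_graph G].

Local Open Scope classical_set_scope.
Local Open Scope ring_scope.

Section Spectral.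
Variable R : realType.

(* Matrices are indexed by ordinals, so vertices are numbered by [enum_val]. *)
Definition adj_mx (G : sgraph) : 'M[R]_#|G| :=
  \matrix_(i, j) (adj (enum_val i) (enum_val j))%:R.

Definition deg_mx (G : sgraph) : 'M[R]_#|G| :=
  diag_mx (\row_i (degree (enum_val i))%:R).

Definition Aalpha (alpha : R) (G : sgraph) : 'M[R]_#|G| :=
  alpha *: deg_mx G + (1 - alpha) *: adj_mx G.

(* The set of eigenvalues is finite, and it is nonempty when [G] has a vertex
   because the matrix is real symmetric; its supremum is then its largest
   element. *)
Definition Aalpha_radius (alpha : R) (G : sgraph) : R :=
  sup [set x : R | eigenvalue (Aalpha alpha G) x].

Definition maximizes_radius (alpha : R) (n m : nat) (G : sgraph) : Prop :=
  inH n m G /\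
  forall H : sgraph, inH n m H -> Aalpha_radius alpha H <= Aalpha_radius alpha G.

End Spectral.

(* Main.v *)
Require Import Defs.
From mathcomp Require Import all_boot all_order all_algebra.
From mathcomp Require Import all_classical all_reals.
From mathcomp Require Import topology normedtype derive.
From mathcomp Require Import ring lra zify.

(** Write [be = 1 - al], [N = n - 1] and let [x] be a Perron vector of a
maximiser [G].  Replacing an edge [uz] by [up] increases the radius when
[x z <= x p], so a vertex [v] with largest entry is dominating.  Normalise
[x v = 1] and let [H = G - v], [T = radius - al]; then
[(T - A_al(H)) x = be 1] on [H] and [T + al - al N = be * sum x], so one has
to bound the total mass of the solution of the first equation.

If [H] has [a <= N - 1] edges, a maximum principle run simultaneously on the
vertex values [x u] and on the edge sums [x u + x w] compares [x] with the
Perron vector of the star; this uses only that at most [a - 1] edges of [H]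
meet a given one, and [al >= 1/2].  Equality forces the edges of [H] to meet
pairwise, so [H] is a star or, when [al = 1/2], possibly a triangle, which has
the same line graph as the star with three edges.

If [H] has [N] edges, the second largest vertex [w] is adjacent to all
non-isolated vertices of [H].  Unless [w] is dominating too, the same maximum
principle on the neighbourhood of [w], together with a test vector on
[S_{n,2n-2}], contradicts an explicit polynomial inequality. *)

Set Implicit Arguments.
Unset Strict Implicit.
Unset Printing Implicit Defensive.

Import Order.TTheory GRing.Theory Num.Theory numFieldNormedType.Exports.

(** * Colourings, degrees and edges *)

(** The hypothesis [al >= 1/2] enters through the identity [al * x u + be * x w = (2 * al - 1) * x u
    + be * (x u + x w)]: its coefficients are then nonnegative, so in terms of vertex values and
    edge sums the equations form a monotone system, for which the values on the star are a
    supersolution. At [al = 1/2] the vertex values drop out and only the line graph remains visible,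
    which is why the triangle can tie with the star. The comparison closes because the two equations
    pull in opposite directions: a larger radius forces more total mass through the row of [v],
    while the bound obtained from the rows of [H] then allows less. A star with [N] edges does not
    fit on [N] vertices, so [m = 2n - 2] leaves no star to compare with. There the failure of [w] to
    dominate is measured by the number [h >= 1] of vertices that [w] misses, and the required
    inequality is tight enough to need a good rational approximation of a square root. *)

Lemma colour_iso (C : finType) (M : rel C) (G H : sgraph) (f : G -> C) (g : H -> C) :
  #|G| = #|H| ->
  (forall x y : G, adj x y = (x != y) && M (f x) (f y)) ->
  (forall x y : H, adj x y = (x != y) && M (g x) (g y)) ->
  (forall c, #|[pred x | f x == c]| = #|[pred y | g y == c]|) ->
  graph_iso G H.
Proof.
move=> cGH fE gE cE.
(* A vertex of colour [c] is sent to the vertex of [H] that has the same rank in its own class of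
   colour [c]. *)
pose k c x (px : x \in [pred x | f x == c]) : H :=
  enum_val (cast_ord (cE c) (enum_rank_in px x)).
have px x : x \in [pred z | f z == f x] by rewrite inE.
pose h x := k (f x) x (px x).
have kP c x q : g (@k c x q) = c.
  by apply/eqP; have := enum_valP (cast_ord (cE c) (enum_rank_in q x)); rewrite inE.
have hP x : g (h x) = f x by exact: kP.
have k_inj c c' x x' q q' : c = c' -> @k c x q = @k c' x' q' -> x = x'.
  move=> e; case: _ / e q' => q' /enum_val_inj/cast_ord_inj/(congr1 val) e.
  have := congr1 (fun i => nth x (enum [pred x | f x == c]) i) e.
  by rewrite /= !nth_enum_rank_in.
have h_inj : injective h.
  by move=> x x' e; apply: (k_inj _ _ _ _ _ _ _ e); rewrite -!hP e.
exists h; first by apply: inj_card_bij => //; rewrite cGH.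
by move=> x y; rewrite fE gE !hP (inj_eq h_inj).
Qed.

Lemma graph_iso_sym G H : graph_iso G H -> graph_iso H G.
Proof.
move=> [f [g fK gK] fE]; exists g; first by exists f.
by move=> x y; rewrite -fE !gK.
Qed.

Lemma graph_iso_trans G H K : graph_iso G H -> graph_iso H K -> graph_iso G K.
Proof.
move=> [f bf fE] [g bg gE]; exists (g \o f); first exact: bij_comp.
by move=> x y /=; rewrite gE fE.
Qed.

(** Twice the number of edges, as a double sum: unlike the set of unordered pairs, it splits
    directly along joins and unions and can be compared termwise under [shift]. *)
Definition darts (G : sgraph) : nat := \sum_(u : G) \sum_(w : G) adj u w.

Lemma darts_edges (G : sgraph) : darts G = 2 * #|edges G|.
Proof.
pose S := [set p : G * G | adj p.1 p.2].
have -> : darts G = \sum_(p in S) 1.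
  rewrite /darts pair_big /= [RHS]big_mkcond; apply: eq_bigr => p _.
  by rewrite inE; case: (adj _ _).
have -> : edges G = [set [set p.1; p.2] | p in S].
  by apply/setP => e; apply/imsetP/imsetP => -[p]; rewrite ?inE => pS ->; exists p; rewrite ?inE.
rewrite (partition_big_imset (fun p => [set p.1; p.2])) /= -sum1_card big_distrr /=.
apply: eq_bigr => e /imsetP[[a b]]; rewrite inE /= => ab ->.
have nab : a != b by apply: contraTneq ab => ->; rewrite adj_irr.
have c2 : #|[set (a, b); (b, a)]| = 2 by rewrite cards2 xpair_eqE (negPf nab).
rewrite muln1 sum1_card -c2.
apply: eq_card => -[c d]; rewrite /S !inE /= !xpair_eqE.
apply/andP/orP => [[cd /eqP e2]|[]/andP[/eqP-> /eqP->]]; last 2 first.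
- by rewrite inE /= ab eqxx.
- by rewrite inE /= adj_sym ab finset.setUC eqxx.
rewrite inE /= in cd; have ncd : c != d by apply: contraTneq cd => ->; rewrite adj_irr.
have : c \in [set a; b] by rewrite -e2 !inE eqxx.
have : d \in [set a; b] by rewrite -e2 !inE eqxx orbT.
rewrite !inE => /orP[]/eqP ed /orP[]/eqP ec; move: ncd; rewrite ec ed ?eqxx //; auto.
Qed.

Lemma big_sum_type (A B : finType) (F : A + B -> nat) :
  \sum_u F u = \sum_a F (inl a) + \sum_b F (inr b).
Proof. exact: big_sumType. Qed.

Lemma darts_gjoin G H : darts (gjoin G H) = darts G + darts H + 2 * (#|G| * #|H|).
Proof.
rewrite /darts big_sum_type.
under eq_bigr do rewrite big_sum_type /= sum1_card.
under [X in _ + X]eq_bigr do rewrite big_sum_type /= sum1_card.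
rewrite !big_split /= !sum_nat_const /=.
rewrite !cardT -!cardT; lia.
Qed.

Lemma darts_gunion G H : darts (gunion G H) = darts G + darts H.
Proof.
rewrite /darts big_sum_type.
under eq_bigr do rewrite big_sum_type /= [X in _ + X]big1 // addn0.
by under [X in _ + X = _]eq_bigr do rewrite big_sum_type /= [X in X + _]big1 // add0n.
Qed.

Lemma darts_complete t : darts (complete t) = t * (t - 1).
Proof.
rewrite /darts (eq_bigr (fun=> t - 1)) => [|i _]; first by rewrite sum_nat_const card_ord.
rewrite /= /complete_rel (bigD1 i) //= eqxx add0n (eq_bigr (fun=> 1)) => [|j].
  by rewrite sum1_card subn1 -[in RHS](card_ord t) -(cardC1 (i : 'I_t)); apply: eq_card => j; rewrite !inE.
by rewrite eq_sym => ->.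
Qed.

Lemma darts_edgeless t : darts (edgeless t) = 0.
Proof. by rewrite /darts big1 // => i _; rewrite big1. Qed.

Lemma card_gjoin G H : #|gjoin G H| = #|G| + #|H|.
Proof. exact: card_sum. Qed.

Lemma card_gunion G H : #|gunion G H| = #|G| + #|H|.
Proof. exact: card_sum. Qed.

Definition ideg (G : sgraph) (U : {set G}) (u : G) : nat := \sum_(w in U) adj u w.

(** * Degree sums over edges, and pairwise meeting edges *)

Section InducedDegrees.
Variables (G : sgraph) (U : {set G}) (a : nat).
Hypothesis Ua : \sum_(u in U) ideg U u = 2 * a.

(** The degree sum over [uw] counts the edges meeting [{u, w}], with [uw] counted twice; hence the
    bound [a + 1], and equality leaves no edge disjoint from [uw]. In the proof, each vertex of [V]
    has degree at least its number of neighbours in [{u, w}], and strictly more if it lies on a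
    disjoint edge. *)
Lemma ideg_edge (u w : G) : u \in U -> w \in U -> adj u w ->
  ideg U u + ideg U w <= a + 1 /\
  (a + 1 <= ideg U u + ideg U w -> forall y z, y \in U -> z \in U -> adj y z ->
    [|| y == u, y == w, z == u | z == w]).
Proof.
move=> uU wU uw; have nuw : w != u by apply: contraTneq uw => ->; rewrite adj_irr.
pose V z := [&& z \in U, z != u & z != w].
have split2 (F : G -> nat) : \sum_(z in U) F z = F u + (F w + \sum_(z | V z) F z).
  rewrite (bigD1 u) // (bigD1 w) /=; last by rewrite wU.
  by congr (_ + (_ + _)); apply: eq_bigl => z; rewrite /V -andbA.
have du : ideg U u = 1 + \sum_(z | V z) adj z u.
  rewrite /ideg split2 adj_irr uw add0n; congr (_ + _).
  by apply: eq_bigr => z _; rewrite adj_sym.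
have dw : ideg U w = 1 + \sum_(z | V z) adj z w.
  rewrite /ideg split2 adj_irr adj_sym uw add0n; congr (_ + _).
  by apply: eq_bigr => z _; rewrite adj_sym.
have dz z : adj z u + adj z w <= ideg U z by rewrite /ideg split2 addnA leq_addr.
have le : \sum_(z | V z) (adj z u + adj z w) <= \sum_(z | V z) ideg U z.
  by apply: leq_sum.
have := Ua; rewrite split2 => Ua2; move: (le); rewrite big_split /= => le2.
split=> [|ge y z yU zU yz]; first by move: Ua2 le2; rewrite du dw; clear; lia.
apply: contraT; rewrite !negb_or => /and4P[yu yw zu zw].
have Vy : V y by rewrite /V yU yu.
have Vz : V z by rewrite /V zU zu.
have dy : adj y u + adj y w + 1 <= ideg U y.
  by rewrite /ideg split2 (bigD1 z) //= yz addnA leq_add2l leq_addr.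
have : \sum_(z | V z) (adj z u + adj z w) < \sum_(z | V z) ideg U z.
  rewrite (bigD1 y) //= [X in _ < X](bigD1 y) //=.
  rewrite -addSn; apply: leq_add; last exact: leq_sum.
  by move: dy; rewrite addn1.
move: Ua2 ge; rewrite du dw big_split /=.
move: (\sum_(z0 | V z0) ideg U z0) (\sum_(z0 | V z0) adj z0 u) (\sum_(z0 | V z0) adj z0 w) => A B C.
clear; lia.
Qed.

Lemma ideg_le (u : G) : u \in U -> ideg U u <= a.
Proof.
move=> uU; have := Ua; rewrite (bigD1 u) //=.
have -> : ideg U u = \sum_(z in U | z != u) adj z u.
  rewrite /ideg (bigD1 u) //= adj_irr add0n; apply: eq_bigr => z _; exact: congr1 (adj_sym _ _).
have : \sum_(z in U | z != u) adj z u <= \sum_(z in U | z != u) ideg U z.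
  by apply: leq_sum => z _; rewrite /ideg (bigD1 u) //=; lia.
lia.
Qed.

Lemma ideg_gt0 u w : w \in U -> adj u w -> 0 < ideg U u.
Proof. by move=> wU uw; rewrite /ideg (bigD1 w) //= uw. Qed.

Lemma ideg_gt0P u : 0 < ideg U u -> exists2 w, w \in U & adj u w.
Proof.
rewrite lt0n /ideg sum_nat_eq0 => /forallPn[w]; rewrite negb_imply => /andP[wU].
by case E: (adj u w) => // _; exists w.
Qed.

(* If the degree sum over an edge is extremal, the edges pairwise meet. *)
Lemma star_or_triangle :
  (forall u w, u \in U -> w \in U -> adj u w -> a + 1 <= ideg U u + ideg U w) ->
  0 < a ->
  (exists2 w, w \in U & forall y z, y \in U -> z \in U -> adj y z -> y = w \/ z = w) \/
  a = 3 /\ exists p q r, [/\ [/\ p \in U, q \in U & r \in U], [/\ p != q, p != r & q != r],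
   [/\ adj p q, adj p r & adj q r] & forall y z, y \in U -> z \in U -> adj y z ->
    y \in [:: p; q; r] /\ z \in [:: p; q; r]].
Proof.
move=> ext a0.
have meet u w y z : u \in U -> w \in U -> adj u w -> y \in U -> z \in U -> adj y z ->
    [|| y == u, y == w, z == u | z == w].
  move=> uU wU uw; exact: ((ideg_edge uU wU uw).2 (ext _ _ uU wU uw) y z).
have [p pU [q qU pq]] : exists2 p, p \in U & exists2 q, q \in U & adj p q.
  have : 0 < \sum_(u in U) ideg U u by rewrite Ua; lia.
  rewrite lt0n sum_nat_eq0 => /forallPn[p]; rewrite negb_imply => /andP[pU].
  by rewrite -lt0n => /ideg_gt0P[q qU pq]; exists p => //; exists q.
have npq : p != q by apply: contraTneq pq => ->; rewrite adj_irr.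
(* If one end of [pq] has no further neighbour, all edges pass through the other end. Otherwise the
   edges [pr] and [qz] must meet, so [z = r] and there is a triangle; its degree sum 4 must equal
   [a + 1]. *)
have [/existsP[r /and4P[rU rp rq pr]]|np] :=
  boolP [exists r, [&& r \in U, r != p, r != q & adj p r]]; last first.
  left; exists q => // y z yU zU yz; have := meet _ _ _ _ pU qU pq yU zU yz.
  move: np; rewrite negb_exists => /forallP np.
  have {}np r : r \in U -> adj p r -> r = q.
    move=> rU pr; apply/eqP; apply: contraT => nrq; have := np r.
    by rewrite rU nrq pr (contraTneq _ pr) // => ->; rewrite adj_irr.
  move=> /or4P[]/eqP e; rewrite ?e in yz *; auto.
  by left; apply: (np _ yU); rewrite adj_sym.
have [/existsP[z /and3P[zU zp qz]]|nq] := boolP [exists z, [&& z \in U, z != p & adj q z]].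
  have ezr : z = r.
    have := meet _ _ _ _ pU rU pr qU zU qz.
    by rewrite eq_sym (negPf npq) eq_sym (negPf rq) (negPf zp) /= => /eqP.
  rewrite {}ezr {z zU zp} in qz.
  have cl x y : x \in U -> y \in U -> adj x y -> x \in [:: p; q; r].
    move=> xU yU xy; rewrite !inE; apply: contraT; rewrite !negb_or => /and3P[xp xq xr].
    have := meet _ _ _ _ pU qU pq xU yU xy; rewrite (negPf xp) (negPf xq) /= => /orP[]/eqP ey.
      have := meet _ _ _ _ qU rU qz xU yU xy.
      by rewrite ey (negPf xq) (negPf xr) (negPf npq) /= eq_sym (negPf rp).
    have := meet _ _ _ _ pU rU pr xU yU xy.
    by rewrite ey (negPf xp) (negPf xr) eq_sym (negPf npq) /= eq_sym (negPf rq).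
  right; split; last first.
    exists p, q, r; split=> //; first by rewrite npq eq_sym rp eq_sym rq.
    by move=> y z yU zU yz; split; [exact: cl yz | apply: cl yU _; rewrite // adj_sym].
  have deg2 u v w : u \in U -> v \in U -> w \in U -> v != w -> adj u v -> adj u w ->
      (forall z, z \in U -> adj u z -> z = v \/ z = w) -> ideg U u = 2.
    move=> uU vU wU vw uv uw only; rewrite /ideg (bigD1 v) //= (bigD1 w) /=; last by rewrite wU eq_sym.
    rewrite uv uw big1 // => z /andP[/andP[zU zv] zw]; case E: (adj u z) => //.
    by case: (only z zU E) => e; rewrite e eqxx in zv zw.
  have dp : ideg U p = 2.
    apply: (deg2 _ q r) => //; first by rewrite eq_sym.
    move=> z zU pz; have := cl z p zU pU; rewrite adj_sym => /(_ pz).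
    by rewrite !inE => /or3P[]/eqP e; auto; move: pz; rewrite e adj_irr.
  have dq : ideg U q = 2.
    apply: (deg2 _ p r) => //; [by rewrite eq_sym | by rewrite adj_sym |].
    move=> z zU pz; have := cl z q zU qU; rewrite adj_sym => /(_ pz).
    by rewrite !inE => /or3P[]/eqP e; auto; move: pz; rewrite e adj_irr.
  have := ext _ _ pU qU pq; have := (ideg_edge pU qU pq).1; rewrite dp dq; lia.
left; exists p => // y z yU zU yz; have := meet _ _ _ _ pU qU pq yU zU yz.
move: nq; rewrite negb_exists => /forallP nq.
have {}nq z' : z' \in U -> adj q z' -> z' = p.
  by move=> z'U qz'; apply/eqP; apply: contraT => nzp; have := nq z'; rewrite z'U nzp qz'.
move=> /or4P[]/eqP e; rewrite ?e in yz *; auto.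
by left; apply: (nq _ yU); rewrite adj_sym.
Qed.

End InducedDegrees.

(** * The scalar inequality *)

Local Open Scope ring_scope.

Ltac nonneg := lazymatch goal with |- is_true (@Order.le _ _ _ ?x) =>
  lazymatch x with
  | @GRing.exp _ _ _ => first [apply: exprn_ge0; assumption | exact: sqr_ge0]
  | @GRing.natmul _ _ _ => exact: ler0n
  | @GRing.inv _ _ => rewrite invr_ge0; nonneg
  | 1%R => exact: ler01
  | _ => first [ assumption | apply: addr_ge0; nonneg | apply: mulr_ge0; nonneg ]
  end end.

(* Digit groups: [12,,345] is 12345. *)
Local Notation "x ,, y" := (x * 1000 + y) (at level 39, left associativity).

Section ScalarInequality.
Variable R : realFieldType.

(* In the shifted variables [b, c, p, q >= 0] the expansions below have (almost)
   only positive coefficients.  The constant 19/11 approximates [sqrt 3] from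
   below; see [two_hub_E_ge]. *)
Lemma quartic_slope_ge0 (b c p q a s tau t : R) :
  0 <= b -> 0 <= c -> 0 <= p -> 0 <= q ->
  a = b + c -> s = p + a ^+ 2 + 19 / 11 * b ^+ 2 ->
  tau = q + s + a ^+ 2 -> t = tau + a * (a + b) ->
  0 <= tau * s * t * (t + c * (a + b))
       - 4 * b ^+ 2 * (2 * a * (a + b) * (tau + a ^+ 2) - tau * s) * (t + a ^+ 2).
Proof.
move=> b0 c0 p0 q0 ea es etau et.
(* [14641 = 11 ^ 4] clears the denominators: the leading product has four factors containing
   [19 / 11]. *)
rewrite -(@pmulr_rge0 _ (14 ,, 641)) //; last by lra.
rewrite [X in 0 <= X](_ : _ =
  ((1 ,, 437 ,, 022) * b ^+ 8 + (4 ,, 453 ,, 526) * b ^+ 7 * c + (12 ,, 396 ,, 747) * b ^+ 6 * c ^+ 2 + (24 ,, 937 ,, 858) * b ^+ 5 * c ^+ 3 + (31 ,, 594 ,, 794) * b ^+ 4 * c ^+ 4 + (24 ,, 558 ,, 281) * b ^+ 3 * c ^+ 5 + (11 ,, 542 ,, 432) * b ^+ 2 * c ^+ 6 + (3 ,, 016 ,, 046) * b * c ^+ 7 + (351 ,, 384) * c ^+ 8)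
  + ((2 ,, 001 ,, 054) * b ^+ 6 + (5 ,, 842 ,, 606) * b ^+ 5 * c + (10 ,, 346 ,, 105) * b ^+ 4 * c ^+ 2 + (11 ,, 052 ,, 624) * b ^+ 3 * c ^+ 3 + (7 ,, 100 ,, 885) * b ^+ 2 * c ^+ 4 + (2 ,, 445 ,, 047) * b * c ^+ 5 + (380 ,, 666) * c ^+ 6) * q
  + ((531 ,, 674) * b ^+ 4 + (1 ,, 008 ,, 898) * b ^+ 3 * c + (1 ,, 108 ,, 723) * b ^+ 2 * c ^+ 2 + (556 ,, 358) * b * c ^+ 3 + (131 ,, 769) * c ^+ 4) * q ^+ 2
  + ((39 ,, 930) * b ^+ 2 + (29 ,, 282) * b * c + (14 ,, 641) * c ^+ 2) * q ^+ 3
  + ((5 ,, 259 ,, 529) * b ^+ 6 + (16 ,, 304 ,, 750) * b ^+ 5 * c + (26 ,, 068 ,, 361) * b ^+ 4 * c ^+ 2 + (24 ,, 765 ,, 917) * b ^+ 3 * c ^+ 3 + (14 ,, 463 ,, 977) * b ^+ 2 * c ^+ 4 + (4 ,, 758 ,, 325) * b * c ^+ 5 + (732 ,, 050) * c ^+ 6) * p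
  + ((2 ,, 780 ,, 943) * b ^+ 4 + (5 ,, 664 ,, 736) * b ^+ 3 * c + (5 ,, 732 ,, 617) * b ^+ 2 * c ^+ 2 + (2 ,, 796 ,, 431) * b * c ^+ 3 + (644 ,, 204) * c ^+ 4) * p * q
  + ((400 ,, 631) * b ^+ 2 + (380 ,, 666) * b * c + (175 ,, 692) * c ^+ 2) * p * q ^+ 2
  + ((14 ,, 641)) * p * q ^+ 3
  + ((2 ,, 249 ,, 269) * b ^+ 4 + (4 ,, 655 ,, 838) * b ^+ 3 * c + (4 ,, 623 ,, 894) * b ^+ 2 * c ^+ 2 + (2 ,, 240 ,, 073) * b * c ^+ 3 + (512 ,, 435) * c ^+ 4) * p ^+ 2
  + ((681 ,, 472) * b ^+ 2 + (673 ,, 486) * b * c + (307 ,, 461) * c ^+ 2) * p ^+ 2 * q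
  + ((43 ,, 923)) * p ^+ 2 * q ^+ 2
  + ((320 ,, 771) * b ^+ 2 + (322 ,, 102) * b * c + (146 ,, 410) * c ^+ 2) * p ^+ 3
  + ((43 ,, 923)) * p ^+ 3 * q
  + ((14 ,, 641)) * p ^+ 4); last by rewrite et etau es ea; field.
by nonneg.
Qed.

(** Homogeneous form of [main_gt0] with [E] at its lower bound. There [a + b = al + be = 1], the
    letters [s], [tau], [t] stand for [al] times the quantities of the same name, and [e] for [al]
    times the lower bound. *)
Lemma quartic_gt0 (b c p q a s tau t w e : R) :
  0 < b -> 0 <= c -> 0 <= p -> 0 <= q ->
  a = b + c -> s = p + a ^+ 2 + 19 / 11 * b ^+ 2 ->
  tau = q + s + a ^+ 2 -> t = tau + a * (a + b) ->
  w = t + c * (a + b) -> e = 2 * a * b + 19 / 11 * b ^+ 2 ->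
  0 < tau * s * t * (e * w - 2 * b ^+ 2 * (tau - s))
       - 2 * b ^+ 2 * (2 * a * (a + b) * (tau + a ^+ 2) - tau * s)
         * (2 * e * (t + a ^+ 2) + (tau - s) * w).
Proof.
move=> b0 c0 p0 q0 ea es etau et ew ee; have b0' := ltW b0.
(* [161051 = 11 ^ 5] clears the denominators. The only negative coefficient, that of [b ^+ 9 * c],
   is absorbed in [(b - c) ^+ 2]; the separate term in [b ^+ 10] gives strictness. *)
rewrite -(@pmulr_rgt0 _ (161 ,, 051)) //; last by lra.
rewrite [X in 0 < X](_ : _ = (23 ,, 823 ,, 711) * b ^+ 10 + (
  ((211 ,, 343) * b ^+ 8 * (b - c) ^+ 2 + (14 ,, 371 ,, 412) * b ^+ 8 * c ^+ 2 + (343 ,, 840 ,, 376) * b ^+ 7 * c ^+ 3 + (870 ,, 837 ,, 484) * b ^+ 6 * c ^+ 4 + (1 ,, 054 ,, 667 ,, 097) * b ^+ 5 * c ^+ 5 + (740 ,, 701 ,, 500) * b ^+ 4 * c ^+ 6 + (311 ,, 238 ,, 378) * b ^+ 3 * c ^+ 7 + (73 ,, 673 ,, 512) * b ^+ 2 * c ^+ 8 + (7 ,, 730 ,, 448) * b * c ^+ 9)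
  + ((33 ,, 690 ,, 646) * b ^+ 8 + (73 ,, 990 ,, 774) * b ^+ 7 * c + (154 ,, 087 ,, 813) * b ^+ 6 * c ^+ 2 + (263 ,, 561 ,, 958) * b ^+ 5 * c ^+ 3 + (282 ,, 351 ,, 685) * b ^+ 4 * c ^+ 4 + (174 ,, 008 ,, 285) * b ^+ 3 * c ^+ 5 + (58 ,, 124 ,, 770) * b ^+ 2 * c ^+ 6 + (8 ,, 374 ,, 652) * b * c ^+ 7) * q
  + ((7 ,, 040 ,, 506) * b ^+ 6 + (10 ,, 778 ,, 438) * b ^+ 5 * c + (19 ,, 279 ,, 535) * b ^+ 4 * c ^+ 2 + (22 ,, 078 ,, 628) * b ^+ 3 * c ^+ 3 + (12 ,, 810 ,, 875) * b ^+ 2 * c ^+ 4 + (2 ,, 898 ,, 918) * b * c ^+ 5) * q ^+ 2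
  + ((348 ,, 722) * b ^+ 4 + (146 ,, 410) * b ^+ 3 * c + (600 ,, 281) * b ^+ 2 * c ^+ 2 + (322 ,, 102) * b * c ^+ 3) * q ^+ 3
  + ((202 ,, 170 ,, 969) * b ^+ 8 + (721 ,, 892 ,, 292) * b ^+ 7 * c + (1 ,, 304 ,, 493 ,, 619) * b ^+ 6 * c ^+ 2 + (1 ,, 456 ,, 610 ,, 463) * b ^+ 5 * c ^+ 3 + (1 ,, 056 ,, 879 ,, 219) * b ^+ 4 * c ^+ 4 + (486 ,, 886 ,, 455) * b ^+ 3 * c ^+ 5 + (131 ,, 154 ,, 078) * b ^+ 2 * c ^+ 6 + (16 ,, 105 ,, 100) * b * c ^+ 7) * p
  + ((97 ,, 972 ,, 127) * b ^+ 6 + (249 ,, 687 ,, 614) * b ^+ 5 * c + (310 ,, 877 ,, 677) * b ^+ 4 * c ^+ 2 + (216 ,, 291 ,, 493) * b ^+ 3 * c ^+ 3 + (83 ,, 424 ,, 418) * b ^+ 2 * c ^+ 4 + (14 ,, 172 ,, 488) * b * c ^+ 5) * p * q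
  + ((13 ,, 849 ,, 055) * b ^+ 4 + (21 ,, 200 ,, 168) * b ^+ 3 * c + (14 ,, 611 ,, 718) * b ^+ 2 * c ^+ 2 + (3 ,, 865 ,, 224) * b * c ^+ 3) * p * q ^+ 2
  + ((600 ,, 281) * b ^+ 2 + (322 ,, 102) * b * c) * p * q ^+ 3
  + ((90 ,, 931 ,, 621) * b ^+ 6 + (236 ,, 508 ,, 052) * b ^+ 5 * c + (287 ,, 820 ,, 764) * b ^+ 4 * c ^+ 2 + (191 ,, 636 ,, 049) * b ^+ 3 * c ^+ 3 + (69 ,, 969 ,, 339) * b ^+ 2 * c ^+ 4 + (11 ,, 273 ,, 570) * b * c ^+ 5) * p ^+ 2
  + ((26 ,, 651 ,, 944) * b ^+ 4 + (41 ,, 316 ,, 902) * b ^+ 3 * c + (27 ,, 100 ,, 491) * b ^+ 2 * c ^+ 2 + (6 ,, 764 ,, 142) * b * c ^+ 3) * p ^+ 2 * q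
  + ((1 ,, 800 ,, 843) * b ^+ 2 + (966 ,, 306) * b * c) * p ^+ 2 * q ^+ 2
  + ((13 ,, 151 ,, 611) * b ^+ 4 + (20 ,, 263 ,, 144) * b ^+ 3 * c + (13 ,, 089 ,, 054) * b ^+ 2 * c ^+ 2 + (3 ,, 221 ,, 020) * b * c ^+ 3) * p ^+ 3
  + ((1 ,, 800 ,, 843) * b ^+ 2 + (966 ,, 306) * b * c) * p ^+ 3 * q
  + ((600 ,, 281) * b ^+ 2 + (322 ,, 102) * b * c) * p ^+ 4)); last by rewrite ee ew et etau es ea; field.
apply: ltr_wpDr; first by nonneg.
by rewrite mulr_gt0 ?exprn_gt0 //; lra.
Qed.

End ScalarInequality.

(* [h + 1] is the number of edges of [H] that avoid the second hub [w],
   [N] the number of vertices of [H], and [E_ge] comes from the test vector. *)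
Section TwoHub.
Variable R : realFieldType.
Variables (al be N h t T E s : R).
Hypotheses (albe : al + be = 1) (be_gt0 : 0 < be) (be_le : be <= al).
Hypotheses (h_ge1 : 1 <= h) (N_ge : h + 4 <= N) (t_gt1 : 1 < t).
Hypotheses (TE : T = t + al) (EE : E = T + 1 - al * N) (sE : s = t - 1 - al * h).
Hypothesis E_ge : 2 * be + 2 * be ^+ 2 * ((N - 1 + 2 / (t - 1)) / t) <= E.

Ltac hyps := move: albe be_gt0 be_le h_ge1 N_ge t_gt1 TE EE sE => ? ? ? ? ? ? ? ? ?.

Let al_gt0 : 0 < al. Proof. exact: lt_le_trans be_gt0 be_le. Qed.
Let tau := t - 1.
Let tau_gt0 : 0 < tau. Proof. by rewrite subr_gt0. Qed.

(** Eliminating [N] through [al * N = t + al + 1 - E] makes [E_ge] a linear inequality for [E]. With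
    [k] in place of [19 / 11], the claim at [al = be] reduces to [(2 - k) * tau ^+ 2 - 2 * (k - 1) *
    tau + 2 >= 0], whose discriminant is [4 * k ^+ 2 - 12]; hence a rational just below [sqrt 3]. *)
Lemma two_hub_E_ge : al * (2 * be) + 19 / 11 * be ^+ 2 <= al * E.
Proof.
hyps; have al0 := al_gt0.
have D_gt0 : 0 < al * t + 2 * be ^+ 2 by rewrite ltr_wpDr ?mulr_ge0 ?sqr_ge0 ?mulr_gt0 //; lra.
have H : (2 * be * t + 2 * be ^+ 2 + 4 * al * be ^+ 2 / tau) <= E * (al * t + 2 * be ^+ 2).
  have := E_ge; rewrite -(@ler_pM2l _ (al * t)); last by rewrite mulr_gt0 //; lra.
  have -> : al * t * (2 * be + 2 * be ^+ 2 * ((N - 1 + 2 / (t - 1)) / t)) =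
     2 * al * be * t + 2 * be ^+ 2 * (al * N - al) + 4 * al * be ^+ 2 / tau.
    rewrite /tau; field; apply/andP; split; rewrite gt_eqF //; lra.
  have -> : al * N = t + al + 1 - E by lra.
  have -> : 2 * be * t = 2 * (al + be) * be * t by rewrite albe mulr1.
  by move=> le; rewrite -subr_ge0; move: le; rewrite -subr_ge0; congr (_ <= _); ring.
rewrite -(ler_pM2r D_gt0) -(mulrA al E).
apply: le_trans (ler_wpM2l (ltW al_gt0) H).
rewrite -subr_ge0 -(pmulr_rge0 _ tau_gt0).
have -> : tau * (al * (2 * be * t + 2 * be ^+ 2 + 4 * al * be ^+ 2 / tau)
    - (al * (2 * be) + 19 / 11 * be ^+ 2) * (al * t + 2 * be ^+ 2)) =
  tau * (al * (2 * be * t + 2 * be ^+ 2)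
    - (al * (2 * be) + 19 / 11 * be ^+ 2) * (al * t + 2 * be ^+ 2)) +
  4 * al ^+ 2 * be ^+ 2.
  by field; rewrite gt_eqF.
have -> : t = tau + 1 by rewrite /tau; lra.
have eal : al = 1 - be by lra.
pose c := al - be; have c0 : 0 <= c by rewrite /c; lra.
have -> : tau * (al * (2 * be * (tau + 1) + 2 * be ^+ 2)
    - (al * (2 * be) + 19 / 11 * be ^+ 2) * (al * (tau + 1) + 2 * be ^+ 2)) +
  4 * al ^+ 2 * be ^+ 2 = be ^+ 2 / 11 * (be ^+ 2 * (6 * (tau - 8 / 3) ^+ 2 + 4 / 3)
   + be * c * (9 * tau ^+ 2 + 31 * tau + 88)
   + c ^+ 2 * (3 * tau ^+ 2 + 25 * tau + 44)).
  by rewrite /c eal; field.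
have b0 := ltW be_gt0; have tau0 := ltW tau_gt0.
by nonneg.
Qed.

Let T_gt0 : 0 < T. Proof. hyps; have := al_gt0; lra. Qed.
Let t_gt0 : 0 < t. Proof. hyps; lra. Qed.

(** [N >= h + 4] gives [s >= E - 2 + 3 * al]. After inserting the bound on [E], the terms
    [2 * al * be - 2 * al + 3 * al ^+ 2] collapse to [al ^+ 2]. *)
Lemma two_hub_s_ge : al ^+ 2 + 19 / 11 * be ^+ 2 <= al * s.
Proof.
hyps; have : al * (E - 2 + 3 * al) <= al * s.
  rewrite ler_pM2l // sE; suff : al * (h + 4) <= al * N by lra.
  by rewrite ler_pM2l.
apply: le_trans; have := two_hub_E_ge.
rewrite -subr_ge0 => H; rewrite -subr_ge0; apply: le_trans H _.
rewrite le_eqVlt; apply/orP; left; apply/eqP.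
rewrite (_ : be = 1 - al); [ring | lra].
Qed.

Lemma two_hub_s_gt0 : 0 < s.
Proof.
rewrite -(pmulr_rgt0 _ al_gt0); apply: lt_le_trans two_hub_s_ge.
by rewrite ltr_pwDl ?exprn_gt0 // mulr_ge0 ?sqr_ge0 ?divr_ge0.
Qed.

Let w := al * t + (al - be).

(** This is the coefficient of [E] in [main_gt0]; since it is nonnegative, [E] may be replaced there
    by its lower bound. The sign conditions on [c], [p], [q] in the homogeneous inequality become
    [be <= al], [two_hub_s_ge] and [h >= 1]. *)
Let slope : 0 <= tau * s * t * w
   - 4 * be ^+ 2 * (2 * (tau + al) - tau * s) * T.
Proof.
hyps; have := @quartic_slope_ge0 R be (al - be) (al * s - al ^+ 2 - 19 / 11 * be ^+ 2)
  (al * (tau - s - al)) al (al * s) (al * tau) (al * t) (ltW be_gt0).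
rewrite albe !mulr1 => H.
rewrite -(@pmulr_rge0 _ (al ^+ 3)) ?exprn_gt0 //.
have {H} : 0 <= al * tau * (al * s) * (al * t) * (al * t + (al - be)) -
    4 * be ^+ 2 * (2 * al * (al * tau + al ^+ 2) - al * tau * (al * s)) *
    (al * t + al ^+ 2).
  apply: H; rewrite ?subr_ge0 //; try lra.
  - by have := two_hub_s_ge; lra.
  - rewrite mulr_ge0 //; first lra.
    rewrite sE /tau; suff : al * 1 <= al * h by lra.
    by rewrite ler_pM2l.
  - by rewrite /tau; ring.
by rewrite /w TE; congr (_ <= _); ring.
Qed.

Let main_gt0 : 0 < tau * s * t * (E * w - 2 * al * be ^+ 2 * h)
   - 2 * be ^+ 2 * (2 * (tau + al) - tau * s) * (2 * E * T + h * w).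
Proof.
hyps; pose E0 := (al * (2 * be) + 19 / 11 * be ^+ 2) / al.
have E0E : E0 <= E by rewrite ler_pdivrMr // (mulrC E) two_hub_E_ge.
have alE0 : al * E0 = al * (2 * be) + 19 / 11 * be ^+ 2 by rewrite mulrC divfK ?gt_eqF.
have H : 0 < tau * s * t * (E0 * w - 2 * al * be ^+ 2 * h)
   - 2 * be ^+ 2 * (2 * (tau + al) - tau * s) * (2 * E0 * T + h * w).
  rewrite -(@pmulr_rgt0 _ (al ^+ 4)) ?exprn_gt0 //.
  have := @quartic_gt0 R be (al - be) (al * s - al ^+ 2 - 19 / 11 * be ^+ 2)
    (al * (tau - s - al)) al (al * s) (al * tau) (al * t) w (al * E0) be_gt0.
  rewrite albe !mulr1 => H.
  have {H} : 0 < al * tau * (al * s) * (al * t) * (al * E0 * w - 2 * be ^+ 2 * (al * tau - al * s)) -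
   2 * be ^+ 2 * (2 * al * (al * tau + al ^+ 2) - al * tau * (al * s)) *
   (2 * (al * E0) * (al * t + al ^+ 2) + (al * tau - al * s) * w).
    apply: H; rewrite ?subr_ge0 //; try lra.
    - by have := two_hub_s_ge; lra.
    - rewrite mulr_ge0 //; first lra.
      rewrite sE /tau; suff : al * 1 <= al * h by lra.
      by rewrite ler_pM2l.
    - by rewrite /tau; ring.
  have -> : al * tau - al * s = al ^+ 2 * h by rewrite sE /tau; ring.
  by rewrite TE; congr (_ < _); ring.
apply: lt_le_trans H _; rewrite -subr_ge0.
have dE : 0 <= E - E0 by rewrite subr_ge0.
have := mulr_ge0 dE slope; congr (_ <= _); ring.
Qed.

(** For a Perron vector with [x v = 1], [E] is [be] times its total mass, [F] is [be] times the mass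
    off the [h] vertices missed by [w], and [x w = F / (E + al * h)]. The maximum principle around
    [w] bounds [F * (E + al * h)] above by the left side, so this inequality rules the configuration
    out. *)
Lemma two_hub_ineq F : F = E - h * be ^+ 2 / T ->
  be * (E + al * h + F) * (1 + be * ((N - h - 1 + 2 * (h + 1) / s) / t))
    < F * (E + al * h).
Proof.
hyps; move=> FE; have al0 := al_gt0; have t0 := t_gt0; have s0 := two_hub_s_gt0.
have n1 : t - 1 != 0 by rewrite gt_eqF // subr_gt0.
have n2 : t != 0 by rewrite gt_eqF.
have n3 : s != 0 by rewrite gt_eqF.
have n4 : T != 0 by rewrite gt_eqF.
pose f := (2 * (tau + al) - tau * s) / (tau * s).
(* Half of [E_ge] absorbs all terms containing [N]; what remains is a correction proportional to
   [h], so a factor [h] splits off from the final difference. *)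
have Y : be * (1 + be * ((N - h - 1 + 2 * (h + 1) / s) / t)) <= E / 2 + be ^+ 2 * (h * f / t).
  have -> : be * (1 + be * ((N - h - 1 + 2 * (h + 1) / s) / t)) =
     (2 * be + 2 * be ^+ 2 * ((N - 1 + 2 / (t - 1)) / t)) / 2 + be ^+ 2 * (h * f / t).
    rewrite /f /tau; move: n3; rewrite sE => n3; field.
    by rewrite ?n1 ?n2 ?n3.
  by rewrite lerD2r ler_pM2r ?invr_gt0.
have E2 : 2 * be <= E.
  apply: le_trans E_ge; rewrite lerDl; apply: mulr_ge0; first by rewrite mulr_ge0 ?sqr_ge0.
  rewrite divr_ge0 ?(ltW t0) // addr_ge0 ?divr_ge0 //; last by lra.
  by rewrite subr_ge0; lra.
have F0 : 0 <= F.
  rewrite FE subr_ge0 ler_pdivrMr //.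
  have hT : h * be <= T.
    have : al * h <= T by have := s0; rewrite sE; lra.
    by apply: le_trans; rewrite mulrC ler_wpM2r //; lra.
  apply: (@le_trans _ _ (be * T)); first by rewrite expr2 mulrA mulrC ler_pM2l.
  by rewrite ler_pM2r //; lra.
have G0 : 0 <= E + al * h + F by rewrite !addr_ge0 ?mulr_ge0 //; lra.
have := ler_wpM2l G0 Y; rewrite mulrCA mulrA => H; apply: le_lt_trans H _.
rewrite -subr_gt0.
have -> : F * (E + al * h) - (E + al * h + F) * (E / 2 + be ^+ 2 * (h * f / t)) =
  h / (2 * T * t * tau * s) * (tau * s * t * (E * w - 2 * al * be ^+ 2 * h)
   - 2 * be ^+ 2 * (2 * (tau + al) - tau * s) * (2 * E * T + h * w)).
  have -> : w = al * T - be ^+ 2.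
    by rewrite /w TE (_ : be = 1 - al); [ring | lra].
  rewrite FE /f; field; rewrite n2 n3 n4 /tau n1 //.
by rewrite mulr_gt0 ?main_gt0 // divr_gt0 ?mulr_gt0 //; lra.
Qed.

End TwoHub.

(** * Perron vectors *)

Section RayleighMax.
Variable R : realType.

Lemma sum_continuous (T : topologicalType) (I : finType) (f : I -> T -> R) :
  (forall i, continuous (f i)) -> continuous (fun x => \sum_i f i x).
Proof.
move=> cf x; apply: cvg_big => [|i _]; last exact: cf.
exact: add_continuous.
Qed.

(** Extreme value theorem on the Euclidean unit sphere, transported to row vectors; their norm is
    the sup norm, so boundedness is checked coordinatewise. Homogeneity extends the maximum from the
    sphere to every [y]. *)
Lemma rayleigh_max (I : finType) (i0 : I) (A : I -> I -> R) :
  exists2 x : I -> R, \sum_i x i ^+ 2 = 1 &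
    forall y : I -> R, \sum_i \sum_j y i * A i j * y j
      <= (\sum_i \sum_j x i * A i j * x j) * \sum_i y i ^+ 2.
Proof.
pose vec (v : 'rV[R]_#|I|) i : R := v 0 (enum_rank i).
have vecE (y : I -> R) i : vec (\row_k y (enum_val k)) i = y i.
  by rewrite /vec mxE enum_rankK.
pose quad (v : 'rV[R]_#|I|) := \sum_i \sum_j vec v i * A i j * vec v j.
pose nrm2 (v : 'rV[R]_#|I|) := \sum_i vec v i ^+ 2.
have cvec i : continuous (vec^~ i) by exact: coord_continuous.
have cquad : continuous quad.
  apply: sum_continuous => i; apply: sum_continuous => j v.
  apply: (@continuousM _ _ (fun v => vec v i * A i j) (vec^~ j)); last exact: (cvec j v).
  by apply: (@continuousM _ _ (vec^~ i) (fun=> A i j)); [exact: (cvec i v) | exact: cst_continuous].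
have cnrm2 : continuous nrm2.
  apply: sum_continuous => i v.
  by apply: (@continuousM _ _ (vec^~ i) (vec^~ i)); exact: (cvec i v).
pose S := (nrm2 @^-1` [set 1])%classic.
have clS : closed S.
  by apply: preimage_closed => [v _|]; [exact: cnrm2 | exact: closed_eq].
have bdS : bounded_set S.
  exists 1; split => // M M1 v /= Sv.
  rewrite [leLHS]/Num.norm /= mx_normrE; apply/bigmax_leP => /=; split.
    by rewrite (le_trans _ (ltW M1)).
  move=> [i k] _ /=; rewrite (ord1 i); apply: le_trans (ltW M1).
  rewrite -(enum_valK k) -/(vec v (enum_val k)).
  rewrite -(@ler_pXn2r _ 2) ?nnegrE ?normr_ge0 // expr1n -normrX ger0_norm ?sqr_ge0 //.
  rewrite -Sv /nrm2 (bigD1 (enum_val k)) //= lerDl.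
  by apply: sumr_ge0 => j _; exact: sqr_ge0.
have S0 : (S !=set0)%classic.
  pose e i : R := (i == i0)%:R.
  exists (\row_k e (enum_val k)); rewrite /S /= /nrm2.
  rewrite (bigD1 i0) //= vecE /e eqxx expr1n big1 ?addr0 // => i /negPf ni0.
  by rewrite (vecE e) /e ni0 expr0n.
have [x xS xmax] := EVT_max_rV S0 (bounded_closed_compact bdS clS)
  (continuous_subspaceT cquad).
have Sx : nrm2 x = 1 by move: xS; rewrite inE.
exists (vec x) => // y.
have [s0|yn0] := eqVneq (\sum_i y i ^+ 2) 0.
  have y0 i : y i = 0.
    apply/eqP; rewrite -sqrf_eq0; apply/eqP.
    by apply: (psumr_eq0P _ s0) => // j _; exact: sqr_ge0.
  rewrite s0 mulr0 big1 // => i _.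
  by rewrite big1 // => j _; rewrite y0 !mul0r.
have ygt0 : 0 < \sum_i y i ^+ 2.
  by rewrite lt_neqAle eq_sym yn0 sumr_ge0 // => i _; exact: sqr_ge0.
set s := \sum_i y i ^+ 2 in yn0 ygt0 *.
pose c := (Num.sqrt s)^-1.
have c2 : c ^+ 2 = s^-1 by rewrite /c exprVn sqr_sqrtr // ltW.
pose z i := c * y i.
have zE i : vec (\row_k z (enum_val k)) i = c * y i by exact: vecE.
have nz : nrm2 (\row_k z (enum_val k)) = 1.
  rewrite /nrm2; under eq_bigr do rewrite zE exprMn c2.
  by rewrite -mulr_sumr mulVf.
have qz : quad (\row_k z (enum_val k)) = s^-1 * \sum_i \sum_j y i * A i j * y j.
  rewrite /quad mulr_sumr; apply: eq_bigr => i _; rewrite mulr_sumr.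
  by apply: eq_bigr => j _; rewrite !zE -c2; ring.
have : quad (\row_k z (enum_val k)) <= quad x by apply: xmax; rewrite inE.
by rewrite qz mulrC ler_pdivrMr.
Qed.

End RayleighMax.

Section Operator.
Variables (R : realType) (al : R).

(** Entry [u] of the matrix-vector product, with the diagonal part distributed over the edges at
    [u], so that each edge contributes one term. *)
Definition Aop (G : sgraph) (x : G -> R) (u : G) : R :=
  \sum_(w | adj u w) (al * x u + (1 - al) * x w).

Section Fix_graph.
Variable G : sgraph.
Implicit Types x y : G -> R.

Lemma degreeE (u : G) : degree u = #|adj u|.
Proof. by rewrite /degree cardsE. Qed.

Lemma Aalpha_mulE x j :
  ((\row_i x (enum_val i)) *m Aalpha al G) 0 j = Aop x (enum_val j).
Proof.
rewrite mxE /Aop big_split /= -mulr_sumr sumr_const -degreeE.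
under eq_bigr => i _ do rewrite !mxE !mulrDr.
rewrite big_split /=; congr (_ + _).
  rewrite (bigD1 j) //= eqxx mulr1n big1 ?addr0 => [|i /negPf nij].
    by rewrite -(mulr_natr (x _)) mulrCA.
  by rewrite nij mulr0n !mulr0.
rewrite -(big_enum_val (fun w => x w * ((1 - al) * (adj w (enum_val j))%:R))).
rewrite [RHS]big_mkcond /=; apply: eq_bigr => w _.
by rewrite adj_sym; case: (adj _ _) => /=; ring.
Qed.

Lemma Aop_add x y e u : Aop (fun w => x w + e * y w) u = Aop x u + e * Aop y u.
Proof.
by rewrite /Aop mulr_sumr -big_split /=; apply: eq_bigr => w _; ring.
Qed.

Lemma AopE x u : Aop x u =
  al * (degree u)%:R * x u + (1 - al) * \sum_(w | adj u w) x w.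
Proof.
by rewrite /Aop big_split /= sumr_const -degreeE -(mulr_natr (al * x u)) mulr_sumr; ring.
Qed.

Lemma Aop_sym x y : \sum_u y u * Aop x u = \sum_u x u * Aop y u.
Proof.
have E x' y' : \sum_u y' u * Aop x' u = \sum_u al * (degree u)%:R * x' u * y' u
    + (1 - al) * \sum_u \sum_(w | adj u w) y' u * x' w.
  rewrite mulr_sumr -big_split; apply: eq_bigr => u _ /=.
  by rewrite AopE -mulr_sumr; ring.
rewrite !E; congr (_ + _ * _); first by apply: eq_bigr => u _; ring.
rewrite [RHS](eq_bigr (fun u => \sum_(w | adj w u) x u * y w)); last first.
  by move=> u _; apply: eq_bigl => w; rewrite adj_sym.
rewrite [RHS](exchange_big_dep xpredT) //=.
by apply: eq_bigr => u _; apply: eq_bigr => w _; rewrite mulrC.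
Qed.

Definition qform x := \sum_u x u * Aop x u.
Definition nrm2 x := \sum_u x u ^+ 2.

Lemma nrm2_ge0 x : 0 <= nrm2 x.
Proof. by apply: sumr_ge0 => u _; exact: sqr_ge0. Qed.

Lemma nrm2_gt0 x u : x u != 0 -> 0 < nrm2 x.
Proof.
move=> xu; rewrite /nrm2 (bigD1 u) //= ltr_pwDl ?exprn_even_gt0 //.
by apply: sumr_ge0 => w _; exact: sqr_ge0.
Qed.

Lemma nrm2_eq0 x : nrm2 x = 0 -> forall u, x u = 0.
Proof.
move=> x0 u; apply/eqP; rewrite -sqrf_eq0; apply/eqP.
by apply: (psumr_eq0P _ x0) => // j _; exact: sqr_ge0.
Qed.

(* First-order condition for a maximiser of the Rayleigh quotient: the
   perturbation is taken along the residual itself. *)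
Lemma qform_max_eigen M x : (forall y, qform y <= M * nrm2 y) ->
  qform x = M * nrm2 x -> forall u, Aop x u = M * x u.
Proof.
move=> leM eqx; pose r u := Aop x u - M * x u.
pose B := nrm2 r; pose C := qform r - M * nrm2 r.
have key e : 2 * e * B + e ^+ 2 * C <= 0.
  have := leM (fun w => x w + e * r w).
  rewrite -subr_le0; congr (_ <= _).
  have -> : qform (fun w => x w + e * r w) =
      qform x + 2 * e * (\sum_u r u * Aop x u) + e ^+ 2 * qform r.
    rewrite mulrDl mul1r mulrDl {1}(Aop_sym x r) /qform !mulr_sumr -!big_split /=.
    by apply: eq_bigr => u _; rewrite Aop_add; ring.
  have -> : nrm2 (fun w => x w + e * r w) =
      nrm2 x + 2 * e * (\sum_u r u * x u) + e ^+ 2 * nrm2 r.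
    rewrite /nrm2 !mulr_sumr -!big_split /=; apply: eq_bigr => u _; ring.
  have -> : B = \sum_u r u * Aop x u - M * \sum_u r u * x u.
    by rewrite /B /nrm2 mulr_sumr -sumrB; apply: eq_bigr => u _; rewrite /r; ring.
  by rewrite eqx /C; ring.
have B0 : B = 0.
  apply/eqP; rewrite eq_le nrm2_ge0 andbT leNgt; apply/negP => Bgt0.
  have C1 : 0 < 1 + `|C| by rewrite ltr_pwDl.
  (* For this step size the left side of [key] equals its square times [2 + 2 * |C| + C], which is
     positive. *)
  have := key (B / (1 + `|C|)); apply/negP; rewrite -ltNge.
  rewrite (_ : _ + _ = (B / (1 + `|C|)) ^+ 2 * (2 + 2 * `|C| + C)); last first.
    by field; rewrite gt_eqF.
  rewrite mulr_gt0 ?exprn_gt0 ?divr_gt0 //.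
  by have := ler_normr (- C) C; have := normr_ge0 C; case: (ler0P C) => ? *; lra.
by move=> u; apply/eqP; rewrite -subr_eq0 -/(r u) (nrm2_eq0 B0).
Qed.

Hypotheses (al_lt1 : al < 1) (G_gt0 : (0 < #|G|)%N).

Let radius := Aalpha_radius al G.

(** Off-diagonal entries are nonnegative, so replacing a Rayleigh maximiser by its absolute value
    loses nothing and yields a nonnegative eigenvector. Every eigenvalue is the Rayleigh quotient of
    its eigenvector, so the supremum is the attained maximum [M]. *)
Lemma radius_spec : (forall y, qform y <= radius * nrm2 y) /\
  exists x : G -> R, [/\ forall u, 0 <= x u, exists u, x u != 0
              & forall u, Aop x u = radius * x u].
Proof.
have /card_gt0P[i0 _] := G_gt0.
pose K (i j : G) : R := al * (degree i)%:R * (i == j)%:R + (1 - al) * (adj i j)%:R.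
have qK y : \sum_i \sum_j y i * K i j * y j = qform y.
  apply: eq_bigr => i _; rewrite AopE.
  under eq_bigr do rewrite /K mulrDr mulrDl.
  rewrite big_split /= mulrDr; congr (_ + _).
    rewrite (bigD1 i) //= eqxx big1 => [|j]; first by rewrite mulr1 addr0 -mulrA.
    by rewrite eq_sym => /negPf->; rewrite !(mulr0, mul0r).
  rewrite !mulr_sumr [RHS]big_mkcond; apply: eq_bigr => j _.
  by case: (adj _ _); rewrite /=; ring.
have [x0 nx0 max0] := rayleigh_max i0 K.
pose M := qform x0; pose x u := `|x0 u|.
have leM y : qform y <= M * nrm2 y by rewrite -qK /M -qK.
have nx : nrm2 x = 1.
  by rewrite -nx0; apply: eq_bigr => u _; rewrite real_normK ?num_real.
have qx : qform x = M * nrm2 x.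
  apply/le_anti; rewrite leM /= nx mulr1.
  apply: ler_sum => u _; rewrite /Aop !mulr_sumr; apply: ler_sum => w _.
  have := ler_norm (x0 u * x0 w); rewrite normrM.
  have : x u ^+ 2 = x0 u ^+ 2 by rewrite real_normK ?num_real.
  rewrite -/(x u) -/(x w) => e le.
  have E (p q : R) : p * (al * p + (1 - al) * q) = al * p ^+ 2 + (1 - al) * (p * q) by ring.
  by rewrite !E e lerD2l ler_wpM2l // subr_ge0 ltW.
have eigx := qform_max_eigen leM qx.
have rM : radius = M.
  have ubM : ubound [set a | eigenvalue (Aalpha al G) a]%classic M.
    move=> a /eigenvalueP[v va vn0].
    pose y u := v 0 (enum_rank u).
    have vE : v = \row_i y (enum_val i).
      by apply/rowP => i; rewrite mxE /y enum_valK.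
    have ya u : Aop y u = a * y u.
      have /rowP/(_ (enum_rank u)) := va.
      by rewrite {1}vE Aalpha_mulE enum_rankK mxE.
    have [u yu] : exists u, y u != 0.
      apply/existsP; apply: contraNT vn0; rewrite negb_exists => /forallP y0.
      apply/eqP/rowP => i; rewrite vE !mxE; apply/eqP.
      by have := y0 (enum_val i); rewrite negbK.
    rewrite -(ler_pM2r (nrm2_gt0 yu)); apply: le_trans (leM y).
    by rewrite /qform /nrm2 mulr_sumr ler_sum // => w _; rewrite ya; lra.
  have inM : [set a | eigenvalue (Aalpha al G) a]%classic M.
    apply/eigenvalueP; exists (\row_i x (enum_val i)).
      by apply/rowP => j; rewrite Aalpha_mulE eigx !mxE.
    apply/eqP => /rowP x00; have := nx; rewrite /nrm2 big1 => [/eqP|u _].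
      by rewrite eq_sym oner_eq0.
    by have := x00 (enum_rank u); rewrite !mxE enum_rankK => ->; rewrite expr0n.
  apply/le_anti/andP; split; first by apply: ge_sup => //; exists M.
  by apply: ub_le_sup => //; exists M.
rewrite rM; split=> //; exists x; split=> //; first by move=> u; exact: normr_ge0.
apply/existsP; apply: contraT; rewrite negb_exists => /forallP x00.
  move: nx; rewrite /nrm2 big1 => [/eqP|u _]; first by rewrite eq_sym oner_eq0.
  by have := x00 u; rewrite negbK => /eqP ->; rewrite expr0n.
Qed.

Lemma radius_ub y : qform y <= radius * nrm2 y.
Proof. exact: radius_spec.1. Qed.

(** A zero entry would spread: its row says that a sum of nonnegative neighbouring entries vanishes,
    and connectedness carries this to every vertex. *)
Lemma perron_vector : connected_graph G ->
  exists2 x : G -> R, (forall u, 0 < x u) & forall u, Aop x u = radius * x u.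
Proof.
move=> conn; have [_ [x [x0 [u xu] eigx]]] := radius_spec.
exists x => // w; rewrite lt_neqAle x0 andbT eq_sym.
apply: contraNneq xu => xw0.
have stab (a b : G) : adj a b -> x a = 0 -> x b = 0.
  move=> ab xa; have := eigx a; rewrite xa mulr0 AopE xa mulr0 add0r => /eqP.
  rewrite mulf_eq0 subr_eq0 gt_eqF //= psumr_eq0 => [/allP/(_ b)|c _]; last exact: x0.
  by rewrite mem_index_enum ab => /(_ isT)/eqP.
have /connectP[p pp ->] := conn w u.
by elim: p w xw0 pp => [|a p IH] w xw0 //= => [_|/andP[wa pp]]; 
  [exact/eqP | apply: (IH a) => //; exact: stab xw0].
Qed.

End Fix_graph.
End Operator.

(** * Edge shifting and isomorphism invariance *)

Section EdgeShift.
Variables (G : sgraph) (u z p : G).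

Definition ispair (c d a b : G) := (a == c) && (b == d) || (a == d) && (b == c).

Lemma ispair_sym c d a b : ispair c d a b = ispair c d b a.
Proof. by rewrite /ispair orbC andbC [X in _ || X]andbC. Qed.

Definition shift_rel : rel G := fun a b =>
  (a != b) && (adj a b && ~~ ispair u z a b || ispair u p a b).

Fact shift_sym : symmetric shift_rel.
Proof. by move=> a b; rewrite /shift_rel eq_sym adj_sym !(ispair_sym _ _ a b). Qed.

Fact shift_irr : irreflexive shift_rel.
Proof. by move=> a; rewrite /shift_rel eqxx. Qed.

Definition shift := SGraph shift_sym shift_irr.

Hypotheses (uz : adj u z) (up : ~~ adj u p) (nup : u != p).

Let nuz : u != z.
Proof. by apply: contraTneq uz => ->; rewrite adj_irr. Qed.
Let nzp : z != p.
Proof. by apply: contraNneq up => <-. Qed.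

(** Free of subtraction, so that it can be summed in [nat] for the edge count and cast to [R] for
    the quadratic form. *)
Lemma shift_count a b :
  (shift_rel a b + ispair u z a b = adj a b + ispair u p a b)%N.
Proof.
rewrite /shift_rel; have [->|nab] /= := eqVneq a b.
  rewrite adj_irr /ispair; have [->|_] := eqVneq b u; last by rewrite /= !andbF.
  by rewrite (negPf nuz) (negPf nup).
case E: (ispair u z a b) => /=.
  have -> : adj a b by case/orP: E => /andP[/eqP-> /eqP->]; rewrite // adj_sym.
  rewrite andbF /=; case/orP: E => /andP[/eqP-> /eqP->]; rewrite /ispair ?eqxx (negPf nzp).
    by rewrite (negPf nup) /= ?andbF.
  by rewrite eq_sym (negPf nuz).
case F: (ispair u p a b); rewrite ?orbT ?orbF ?andbT ?addn0 //.
have -> // : adj a b = false.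
by case/orP: F => /andP[/eqP-> /eqP->]; apply/negbTE; rewrite // adj_sym.
Qed.

Lemma sum_pair (R : pzRingType) (F : G -> G -> R) c d : c != d ->
  \sum_a \sum_b (ispair c d a b)%:R * F a b = F c d + F d c.
Proof.
move=> ncd; have one (e f : G) :
    \sum_a \sum_b ((a == e) && (b == f))%:R * F a b = F e f.
  rewrite (bigD1 e) //= (bigD1 f) //= !eqxx mul1r !big1 ?addr0 // => [a|b].
    by move=> /negPf na; rewrite big1 // => b _; rewrite na mul0r.
  by move=> /negPf nb; rewrite nb mul0r.
rewrite -(one c d) -(one d c) -big_split; apply: eq_bigr => a _ /=.
rewrite -big_split; apply: eq_bigr => b _ /=; rewrite -mulrDl; congr (_ * _).
rewrite /ispair; have [->|] := eqVneq a c; rewrite ?(negPf ncd) /= ?orbF ?addr0 //.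
by rewrite add0r.
Qed.

Lemma darts_shift : darts shift = darts G.
Proof.
have e c d : c != d -> (\sum_a \sum_b ispair c d a b = 2)%N.
  move=> /(@sum_pair int (fun _ _ => 1)) => H; apply/eqP.
  rewrite -(eqr_nat int) natr_sum -[X in _ == X]/(1 + 1) -H; apply/eqP.
  by apply: eq_bigr => a _; rewrite natr_sum; apply: eq_bigr => b _; rewrite mulr1.
apply: (@addIn 2%N); rewrite -{1}(e u z) // -(e u p) // /darts -!big_split /=.
apply: eq_bigr => a _; rewrite -!big_split /=; apply: eq_bigr => b _.
exact: shift_count.
Qed.

Variables (R : realType) (al : R) (x : G -> R).
Hypotheses (al_ge0 : 0 <= al) (al_lt1 : al < 1) (x_gt0 : forall a, 0 < x a).
Hypothesis xE : forall a, Aop al x a = Aalpha_radius al G * x a.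
Hypothesis x_le : x z <= x p.

Lemma Aop_sum (H : sgraph) (y : H -> R) a :
  Aop al y a = \sum_b (adj a b)%:R * (al * y a + (1 - al) * y b).
Proof.
rewrite /Aop [LHS]big_mkcond; apply: eq_bigr => b _.
by case: (adj a b) => /=; ring.
Qed.

Let cnt a b : (shift_rel a b)%:R =
  (adj a b)%:R + (ispair u p a b)%:R - (ispair u z a b)%:R :> R.
Proof. by apply/eqP; rewrite eq_sym subr_eq -!natrD shift_count. Qed.

Lemma shift_row :
  Aop al (x : shift -> R) p = Aop al x p + (al * x p + (1 - al) * x u).
Proof.
rewrite !Aop_sum.
have -> : al * x p + (1 - al) * x u = \sum_b (b == u)%:R * (al * x p + (1 - al) * x b).
  by rewrite (bigD1 u) //= eqxx mul1r big1 ?addr0 // => b /negPf->; rewrite mul0r.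
rewrite -big_split; apply: eq_bigr => b _ /=.
rewrite cnt -mulrDl; congr (_ * _); rewrite /ispair eqxx /= ![p == _]eq_sym.
by rewrite (negPf nup) (negPf nzp) /= subr0.
Qed.

(** The quadratic form at [x] does not drop because [x z <= x p]. If the radius did not grow, [x]
    would be an eigenvector of the shifted graph for the same value, but its row at [p] has gained
    the positive term of the edge [up]. *)
Lemma shift_radius : Aalpha_radius al G < Aalpha_radius al shift.
Proof.
have G0 : (0 < #|G|)%N by apply/card_gt0P; exists u.
have pos : 0 < al * x p + (1 - al) * x u.
  by rewrite ltr_wpDl ?mulr_ge0 ?(ltW (x_gt0 _)) // mulr_gt0 ?subr_gt0.
have S0 : (0 < #|shift|)%N by [].
have nrmE : nrm2 (x : shift -> R) = nrm2 x by [].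
have nx := nrm2_gt0 (lt0r_neq0 (x_gt0 u)).
pose F a b := x a * (al * x a + (1 - al) * x b).
have qE (H : sgraph) (y : H -> R) : qform al y =
    \sum_a \sum_b (adj a b)%:R * (y a * (al * y a + (1 - al) * y b)).
  apply: eq_bigr => a _; rewrite Aop_sum mulr_sumr; apply: eq_bigr => b _.
  by rewrite mulrCA.
have q' : qform al (x : shift -> R) = qform al x + (F u p + F p u) - (F u z + F z u).
  rewrite !qE -(sum_pair F nup) -(sum_pair F nuz) -big_split -sumrB /=.
  apply: eq_bigr => a _; rewrite -big_split -sumrB; apply: eq_bigr => b _ /=.
  by rewrite cnt /F; ring.
have gain : F u z + F z u <= F u p + F p u.
  have zp2 : x z ^+ 2 <= x p ^+ 2 by rewrite ler_pXn2r ?nnegrE ?(ltW (x_gt0 _)).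
  have zpu : x u * x z <= x u * x p by rewrite ler_pM2l.
  have := ler_wpM2l al_ge0 zp2; have := ler_wpM2l (_ : 0 <= 1 - al) zpu.
  by rewrite subr_ge0 /F => /(_ (ltW al_lt1)); lra.
have qx : qform al x = Aalpha_radius al G * nrm2 x.
  by rewrite /qform /nrm2 mulr_sumr; apply: eq_bigr => a _; rewrite xE; ring.
rewrite ltNge; apply/negP => le.
have ub := radius_ub al_lt1 S0.
have [req qeq] : Aalpha_radius al shift = Aalpha_radius al G /\
    qform al (x : shift -> R) = Aalpha_radius al shift * nrm2 x.
  have := ub x; rewrite nrmE; move: q' gain qx le nx; clear.
  move: (qform al (x : shift -> R)) (qform al x) (nrm2 x) (Aalpha_radius al shift)
    (Aalpha_radius al G) (F u p + F p u) (F u z + F z u) => q' q N r' r A B.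
  move=> q'E BA qE le N0 q'_le.
  have le' : r' * N <= r * N by rewrite ler_pM2r.
  by split; [apply/le_anti; rewrite le -(ler_pM2r N0) | ]; lra.
have eig := @qform_max_eigen R al shift (Aalpha_radius al shift) (x : shift -> R) ub qeq p.
have := eig; rewrite shift_row xE req => /(canRL (addKr _)); rewrite addNr => B0.
by rewrite B0 ltxx in pos.
Qed.

End EdgeShift.

(** * Isomorphism invariance and existence of a maximiser *)

Section Invariance.
Variables (R : realType) (al : R).
Hypothesis al_lt1 : al < 1.

Implicit Types G H : sgraph.

Lemma eigen_le_radius (G : sgraph) (y : G -> R) mu v :
  y v != 0 -> (forall a, Aop al y a = mu * y a) -> mu <= Aalpha_radius al G.
Proof.
move=> yv yE; have G0 : (0 < #|G|)%N by apply/card_gt0P; exists v.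
rewrite -(ler_pM2r (nrm2_gt0 yv)); apply: le_trans (radius_ub al_lt1 G0 y).
by rewrite /qform /nrm2 mulr_sumr ler_sum // => w _; rewrite yE; lra.
Qed.

Lemma iso_card (G H : sgraph) : graph_iso G H -> #|G| = #|H|.
Proof. by move=> [f /bij_eq_card]. Qed.

Lemma iso_darts G H : graph_iso G H -> darts G = darts H.
Proof.
move=> [f bf fE]; rewrite /darts [RHS](reindex f) /=; last exact: onW_bij.
apply: eq_bigr => u _; rewrite [RHS](reindex f) /=; last exact: onW_bij.
by apply: eq_bigr => w _; rewrite fE.
Qed.

Lemma iso_connected G H : graph_iso G H -> connected_graph G -> connected_graph H.
Proof.
move=> [f [g fK gK] fE] conn a b; rewrite -[a]gK -[b]gK.
have /connectP[s sp ->] := conn (g a) (g b).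
apply/connectP; exists (map f s); last by rewrite last_map.
by rewrite path_map; apply: sub_path sp => c d; rewrite /= fE.
Qed.

Lemma iso_inH n m G H : graph_iso G H -> inH n m G -> inH n m H.
Proof.
move=> GH [cG eG coG]; split; [by rewrite -(iso_card GH) | | exact: iso_connected coG].
by apply/eqP; rewrite -(eqn_pmul2l (isT : (0 < 2)%N)) -darts_edges -(iso_darts GH) darts_edges eG.
Qed.

Lemma iso_radius_le G H : (0 < #|G|)%N -> graph_iso G H ->
  Aalpha_radius al G <= Aalpha_radius al H.
Proof.
move=> G0 [f [g fK gK] fE]; have [_ [x [_ [u xu] xE]]] := radius_spec al_lt1 G0.
apply: (@eigen_le_radius H (x \o g) _ (f u)); first by rewrite /= fK.
move=> a; rewrite -xE -{1}[a]gK /Aop (reindex f) /=; last by apply: onW_bij; exists g.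
by apply: eq_big => [w|w _]; rewrite ?fE // !fK.
Qed.

Lemma iso_radius G H : (0 < #|G|)%N -> graph_iso G H ->
  Aalpha_radius al G = Aalpha_radius al H.
Proof.
move=> G0 GH; apply/le_anti; rewrite !iso_radius_le //; last exact: graph_iso_sym.
by rewrite -(iso_card GH).
Qed.

Lemma iso_maximizes n m G H : (0 < n)%N -> graph_iso G H ->
  maximizes_radius al n m G -> maximizes_radius al n m H.
Proof.
move=> n0 GH [inG maxG]; split; first exact: iso_inH inG.
by move=> K inK; rewrite -(iso_radius _ GH) ?maxG //; case: inG => ->.
Qed.

(** Symmetrised and made irreflexive so that every boolean function is a code of a graph: all graphs
    of order [n] are then represented by a finite type, over which the radius can be maximised. *)
Definition ord_graph_rel n (r : {ffun 'I_n * 'I_n -> bool}) : rel 'I_n :=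
  fun i j => (i != j) && (r (i, j) || r (j, i)).

Fact ord_graph_sym n r : symmetric (@ord_graph_rel n r).
Proof. by move=> i j; rewrite /ord_graph_rel eq_sym orbC. Qed.

Fact ord_graph_irr n r : irreflexive (@ord_graph_rel n r).
Proof. by move=> i; rewrite /ord_graph_rel eqxx. Qed.

Definition ord_graph n r := SGraph (@ord_graph_sym n r) (@ord_graph_irr n r).

Lemma iso_ord_graph (G : sgraph) : exists r, graph_iso G (@ord_graph #|G| r).
Proof.
exists [ffun p => adj (enum_val p.1 : G) (enum_val p.2)].
exists enum_rank; first exact: enum_rank_bij.
move=> a b /=; rewrite /ord_graph_rel !ffunE /= !enum_rankK (inj_eq enum_rank_inj).
by rewrite [adj b a]adj_sym orbb; case: eqVneq => // ->; rewrite adj_irr.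
Qed.

Lemma maximizer_exists n m : (0 < n)%N -> (exists G, inH n m G) ->
  exists G, maximizes_radius al n m G.
Proof.
move=> n0 [G0 inG0].
have code G : inH n m G -> exists r, graph_iso G (@ord_graph n r).
  by case=> <- _ _; exact: iso_ord_graph.
have [r0 iso0] := code _ inG0.
pose D r := `[< inH n m (@ord_graph n r) >].
have D0 : D r0 by apply/asboolP; exact: iso_inH inG0.
case: (@arg_maxP _ _ _ r0 D (fun r => Aalpha_radius al (@ord_graph n r)) D0) => r /asboolP Dr rmax.
exists (ord_graph r); split=> // H inH'; have [s isos] := code _ inH'.
have H0 : (0 < #|H|)%N by case: inH' => ->.
by rewrite (iso_radius H0 isos); apply: rmax; apply/asboolP; exact: iso_inH inH'.
Qed.

End Invariance.

(** * The maximum principle *)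

Section Domination.
Variables (R : realType) (G : sgraph) (U : {set G}).

Lemma idegE (u : G) : (ideg U u)%:R = \sum_(w in U | adj u w) 1 :> R.
Proof.
rewrite /ideg natr_sum big_mkcondr /=; apply: eq_bigr => w _.
by case: (adj _ _).
Qed.

Lemma row_le (u : G) (f : G -> R) (g : R) :
  (forall w, w \in U -> adj u w -> f w <= g) ->
  \sum_(w in U | adj u w) f w <= (ideg U u)%:R * g.
Proof.
move=> fg; rewrite idegE mulr_suml; apply: ler_sum => w /andP[wU uw].
by rewrite mul1r fg.
Qed.

Lemma row_le_but (u v : G) (f : G -> R) (g : R) : v \in U -> adj u v ->
  (forall w, w \in U -> adj u w -> f w <= g) ->
  \sum_(w in U | adj u w) f w <= f v + ((ideg U u)%:R - 1) * g.
Proof.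
move=> vU uv fg; rewrite idegE (bigD1 v) ?vU //= [X in (X - 1)](bigD1 v) ?vU //=.
rewrite lerD2l addrAC subrr add0r mulr_suml; apply: ler_sum => w /andP[/andP[wU uw] _].
by rewrite mul1r fg.
Qed.

(** The eigenvalue equations on [U] after removal of vertices joined to all of [U]: each lowers the
    eigenvalue by [al], giving [T], and adds [1 - al] times its own entry to [k]. *)
Definition linked (al T k : R) (x : G -> R) := forall u, u \in U ->
  T * x u = k + \sum_(w in U | adj u w) (al * x u + (1 - al) * x w).

Variables (al T k : R) (x : G -> R) (a : nat).
Hypotheses (al_ge : 1 / 2 <= al) (al_lt1 : al < 1) (k_gt0 : 0 < k).
Hypothesis xE : linked al T k x.
Hypothesis (Ua : (\sum_(u in U) ideg U u = 2 * a)%N).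

(** Adding the two orientations of an edge turns [al * x u + (1 - al) * x w] into [x u + x w], so
    the total mass depends on [x] only through edge sums. These are therefore the quantities to
    bound. *)
Lemma linked_sum : T * \sum_(u in U) x u = k * #|U|%:R +
  2^-1 * \sum_(u in U) \sum_(w in U | adj u w) (x u + x w).
Proof.
rewrite mulr_sumr (eq_bigr _ xE) big_split /= sumr_const mulr_natr; congr (_ + _).
have sw (f : G -> G -> R) : \sum_(u in U) \sum_(w in U | adj u w) f u w =
    \sum_(u in U) \sum_(w in U | adj u w) f w u.
  rewrite (exchange_big_dep (mem U)) /=; last by move=> ? ? _ /andP[].
  by apply: eq_bigr => u uU; apply: eq_bigl => w; rewrite uU andTb adj_sym.
have -> : \sum_(u in U) \sum_(w in U | adj u w) (al * x u + (1 - al) * x w) =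
   2^-1 * (\sum_(u in U) \sum_(w in U | adj u w) (al * x u + (1 - al) * x w) +
          \sum_(u in U) \sum_(w in U | adj u w) (al * x w + (1 - al) * x u)).
  by have /= := sw (fun u w => al * x u + (1 - al) * x w); lra.
congr (_ * _); rewrite -big_split; apply: eq_bigr => u _ /=.
by rewrite -big_split; apply: eq_bigr => w _ /=; ring.
Qed.

Variables (C P : R).
(** [C] is meant to bound the vertex values, [P] the edge sums, and [g] then each edge term. [C_ge]
    and [P_ge] make the pair a supersolution: a vertex has at most [a] edges, and at most [a - 1]
    edges meet a given edge, whose own two terms add up to its edge sum. *)
Let g := (2 * al - 1) * C + (1 - al) * P.
Hypotheses (C_gt0 : 0 < C) (P_gt0 : 0 < P).
Hypothesis C_ge : k + a%:R * g <= T * C.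
Hypothesis P_ge : 2 * k + P + (a%:R - 1) * g <= T * P.

Let g_gt0 : 0 < g.
Proof.
apply: ltr_wpDl; last by rewrite mulr_gt0 // subr_gt0.
by rewrite mulr_ge0 ?(ltW C_gt0) //; move: al_ge; lra.
Qed.

Let edge_term (th : R) (u w : G) : x u <= th * C -> x u + x w <= th * P ->
  al * x u + (1 - al) * x w <= th * g.
Proof.
move=> xu xuw.
have -> : al * x u + (1 - al) * x w = (2 * al - 1) * x u + (1 - al) * (x u + x w) by ring.
have -> : th * g = (2 * al - 1) * (th * C) + (1 - al) * (th * P) by rewrite /g; ring.
by rewrite lerD // ler_wpM2l //; move: al_ge al_lt1; lra.
Qed.

(* Maximum principle: normalise by the comparison values and look at a vertex
   or an edge where the ratio is largest. *)
Lemma dominated :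
  (forall u, u \in U -> x u <= C) /\
  (forall u w, u \in U -> w \in U -> adj u w -> x u + x w <= P).
Proof.
have [->|/finset.set0Pn[u0 u0U]] := eqVneq U finset.set0.
  by split=> [u|u w]; rewrite inE.
(* A diagonal pair encodes a vertex and an adjacent pair an edge, so that one maximum covers both
   kinds of ratio. *)
pose D (p : G * G) := [&& p.1 \in U, p.2 \in U & (p.1 == p.2) || adj p.1 p.2].
pose F (p : G * G) := if p.1 == p.2 then x p.1 / C else (x p.1 + x p.2) / P.
have D0 : D (u0, u0) by rewrite /D /= u0U eqxx.
case: (@arg_maxP _ _ _ (u0, u0) D F D0) => p Dp Fmax; set th := F p in Fmax.
have nadj (u w : G) : adj u w -> (u == w) = false.
  by move=> uw; apply: contraTF uw => /eqP->; rewrite adj_irr.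
have hU u : u \in U -> x u <= th * C.
  move=> uU; have := Fmax (u, u); rewrite /D /F /= uU eqxx => /(_ isT).
  by rewrite [(_ <= _)%O]ler_pdivrMr.
have hE u w : u \in U -> w \in U -> adj u w -> x u + x w <= th * P.
  move=> uU wU uw; have := Fmax (u, w); rewrite /D /F /= uU wU uw orbT => /(_ isT).
  by rewrite (nadj _ _ uw) [(_ <= _)%O]ler_pdivrMr.
have tE u w : u \in U -> w \in U -> adj u w -> al * x u + (1 - al) * x w <= th * g.
  by move=> uU wU uw; apply: edge_term; [exact: hU | exact: hE].
suff th1 : th <= 1.
  split=> [u uU|u w uU wU uw].
    by apply: le_trans (hU u uU) _; rewrite -[leRHS]mul1r ler_wpM2r // ltW.
  by apply: le_trans (hE u w uU wU uw) _; rewrite -[leRHS]mul1r ler_wpM2r // ltW.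
(* At the maximal vertex or edge the neighbouring terms scale with [th] but the constant [k] does
   not; comparison with [th] times the supersolution gives [th * k <= k]. *)
rewrite leNgt; apply/negP => th1.
have th0 : 0 < th by apply: lt_trans th1.
have thg0 : 0 <= th * g by rewrite mulr_ge0 // ltW.
have := Dp; rewrite /D => /and3P[p1U p2U].
case: (eqVneq p.1 p.2) => [e _|ne /= pp].
  have thC : x p.1 = th * C by rewrite /th /F e eqxx divfK // gt_eqF.
  have := row_le (fun w => tE p.1 w p1U).
  have dle : (ideg U p.1)%:R * (th * g) <= a%:R * (th * g).
    by rewrite ler_wpM2r // ler_nat (ideg_le Ua).
  move=> H; have := le_trans H dle; rewrite -(lerD2l k) -(xE p1U) thC.
  have : th * (k + a%:R * g) <= th * (T * C) by rewrite ler_pM2l.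
  have : 1 * k < th * k by rewrite ltr_pM2r.
  by move=> *; lra.
have thP : x p.1 + x p.2 = th * P by rewrite /th /F (negPf ne) divfK // gt_eqF.
have pp' : adj p.2 p.1 by rewrite adj_sym.
have := row_le_but p2U pp (fun w => tE p.1 w p1U).
have := row_le_but p1U pp' (fun w => tE p.2 w p2U).
rewrite -(lerD2l k) -(xE p2U) => H2; rewrite -(lerD2l k) -(xE p1U) => H1.
have := lerD H1 H2; rewrite -mulrDr thP.
have dle : ((ideg U p.1)%:R + (ideg U p.2)%:R - 2) * (th * g) <= (a%:R - 1) * (th * g).
  rewrite ler_wpM2r //; have [le _] := ideg_edge Ua p1U p2U pp.
  by move: le; rewrite -(@ler_nat R) !natrD; lra.
have : th * (2 * k + P + (a%:R - 1) * g) <= th * (T * P) by rewrite ler_pM2l.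
have : 1 * k < th * k by rewrite ltr_pM2r.
move: thP dle; set d1 := (ideg U p.1)%:R; set d2 := (ideg U p.2)%:R.
by move=> *; lra.
Qed.

Lemma linked_sum_le : T * \sum_(u in U) x u <= k * #|U|%:R + a%:R * P.
Proof.
rewrite linked_sum lerD2l ler_pdivrMl //.
have -> : 2 * (a%:R * P) = \sum_(u in U) (ideg U u)%:R * P.
  by rewrite -mulr_suml -natr_sum Ua natrM mulrA.
by apply: ler_sum => u uU; apply: row_le => w wU uw; exact: dominated.2.
Qed.

(** A slack edge sum would make the mass bound strict. Once all edge sums equal [P], adding the rows
    at both ends of an edge and comparing with [P_ge] leaves no room for a degree sum below
    [a + 1]. *)
Lemma linked_sum_eq : k * #|U|%:R + a%:R * P <= T * \sum_(u in U) x u ->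
  (forall u w, u \in U -> w \in U -> adj u w -> x u + x w = P) /\
  (forall u w, u \in U -> w \in U -> adj u w -> (a + 1 <= ideg U u + ideg U w)%N).
Proof.
move=> ge.
have tight : forall u w, u \in U -> w \in U -> adj u w -> x u + x w = P.
  move=> u w uU wU uw; apply: le_anti; rewrite dominated.2 //= leNgt; apply/negP => lt.
  move: ge; rewrite linked_sum lerD2l ler_pdivlMl //; apply/negP; rewrite -ltNge.
  have -> : 2 * (a%:R * P) = \sum_(u in U) (ideg U u)%:R * P.
    by rewrite -mulr_suml -natr_sum Ua natrM mulrA.
  rewrite (bigD1 u) //= [ltRHS](bigD1 u) //=; apply: ltr_leD; last first.
    apply: ler_sum => y /andP[yU _]; apply: row_le => z zU yz; exact: dominated.2.
  rewrite idegE (bigD1 w) ?wU //= [in ltRHS](bigD1 w) ?wU //= mulrDl mul1r.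
  apply: ltr_leD => //; rewrite mulr_suml.
  by apply: ler_sum => z /andP[/andP[zU uz] _]; rewrite mul1r dominated.2.
split=> // u w uU wU uw.
have wu : adj w u by rewrite adj_sym.
have tE y z : y \in U -> z \in U -> adj y z -> al * x y + (1 - al) * x z <= g.
  move=> yU zU yz; rewrite -[leRHS]mul1r; apply: edge_term; rewrite mul1r.
    exact: dominated.1.
  exact: dominated.2.
have := row_le_but wU uw (fun z => tE u z uU).
have := row_le_but uU wu (fun z => tE w z wU).
rewrite -(lerD2l k) -(xE wU) => H2; rewrite -(lerD2l k) -(xE uU) => H1.
have := lerD H1 H2; rewrite -mulrDr tight //.
have xuw := tight u w uU wU uw => H.
have : (a%:R - 1) * g <= ((ideg U u)%:R + (ideg U w)%:R - 2) * g.
  by have := P_ge; rewrite -xuw in H *; lra.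
by rewrite ler_pM2r // -(@ler_nat R) !natrD; lra.
Qed.

End Domination.

(** * Comparison with the star *)

Definition dominating (G : sgraph) (v : G) := forall w, w != v -> adj v w.

Lemma dominating_connected (G : sgraph) (v : G) : dominating v -> connected_graph G.
Proof.
move=> dom; have conn w : connect adj v w.
  by have [->|/dom vw] := eqVneq w v; [exact: connect0 | exact: connect1].
move=> a b; apply: connect_trans (conn b).
by rewrite sym_connect_sym // => c d; rewrite adj_sym.
Qed.

Lemma connect_closed (G : sgraph) (P : pred G) (v : G) : connected_graph G -> P v ->
  (forall a b, P a -> adj a b -> P b) -> forall w, P w.
Proof.
move=> conn Pv clP w; have /connectP[s sp ->] := conn v w.
elim: s v Pv sp => [|b s IH] v Pv //= /andP[vb sp]; apply: IH sp; exact: clP vb.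
Qed.

Lemma darts_dominating (G : sgraph) (v : G) : dominating v ->
  (darts G = 2 * (#|G| - 1) + \sum_(u in [set~ v]) ideg [set~ v] u)%N.
Proof.
move=> dom; have cU : (\sum_(w | w != v) 1 = #|G| - 1)%N.
  by rewrite sum1_card subn1 -(cardC1 v); apply: eq_card => w; rewrite !inE.
have iE u : u != v -> (\sum_w adj u w = 1 + ideg [set~ v] u)%N.
  move=> uv; rewrite (bigD1 v) //= adj_sym dom //; congr (_ + _)%N.
  by apply: eq_bigl => w; rewrite in_setC1.
rewrite /darts (bigD1 v) //= (bigD1 v) //= adj_irr add0n.
rewrite (eq_bigr (fun=> 1)%N) => [|w /dom->] //.
rewrite (eq_bigr _ iE) big_split /= !cU addnA mul2n addnn; congr (_ + _)%N.
by apply: eq_bigl => w; rewrite in_setC1.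
Qed.

Lemma card_setC1 (G : sgraph) (v : G) : #|[set~ v]| = (#|G| - 1)%N.
Proof. by rewrite cardsC1 subn1. Qed.

(** * Structure of a maximiser *)

Section Maximizer.
Variables (R : realType) (al : R) (n m : nat) (G : sgraph).
Hypotheses (al_ge : 1 / 2 <= al) (al_lt1 : al < 1).
Hypothesis maxG : maximizes_radius al n m G.
Variable x : G -> R.
Hypotheses (x_gt0 : forall a, 0 < x a).
Hypothesis xE : forall a, Aop al x a = Aalpha_radius al G * x a.

Let al_ge0 : 0 <= al. Proof. by apply: le_trans al_ge; rewrite divr_ge0. Qed.

Lemma maximizer_no_shift u z p : adj u z -> ~~ adj u p -> u != p -> x z <= x p ->
  ~ connected_graph (shift u z p).
Proof.
move=> uz up nup zp conn; have [inG max] := maxG.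
have := shift_radius uz up nup al_ge0 al_lt1 x_gt0 xE zp.
apply/negP; rewrite -leNgt; apply: max; case: inG => cG eG _; split=> //.
apply/eqP; rewrite -(eqn_pmul2l (isT : (0 < 2)%N)) -darts_edges.
by rewrite (darts_shift uz up nup) darts_edges eG.
Qed.

(** If [u] is not adjacent to [v] but shares a neighbour [w] with it, replacing [uw] by [uv] keeps
    the graph connected, since the path through [v] substitutes for [uw]. So no vertex is at
    distance two from [v]. *)
Lemma maximizer_dominating v : (forall w, x w <= x v) -> dominating v.
Proof.
move=> xmax; have conn : connected_graph G by case: maxG => -[].
have [/existsP[u /existsP[w /and4P[vw uw nuv vu]]]|none] :=
  boolP [exists u, exists w, [&& adj v w, adj u w, u != v & ~~ adj v u]].
  have [] // := @maximizer_no_shift u w v _ _ _ (xmax w); first by rewrite adj_sym.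
  have nvw : v != w by apply: contraTneq vw => ->; rewrite adj_irr.
  have nuw : u != w by apply: contraTneq uw => ->; rewrite adj_irr.
  have uvw : connect (shift_rel u w v) u w.
    apply: (@connect_trans _ _ v); apply: connect1; rewrite /shift_rel.
      by rewrite nuv /ispair !eqxx orbT.
    by rewrite nvw vw /ispair [v == u]eq_sym (negPf nuv) (negPf nvw).
  have csym := sym_connect_sym (@shift_sym G u w v).
  suff sub : subrel (@adj G) (connect (shift_rel u w v)).
    by move=> a b; apply: (connect_sub sub); exact: conn.
  move=> a b ab; have nab : a != b by apply: contraTneq ab => ->; rewrite adj_irr.
  case E: (ispair u w a b); last by apply: connect1; rewrite /shift_rel nab ab E.
  by case/orP: E => /andP[/eqP-> /eqP->]; rewrite // csym.
pose P w := (w == v) || adj v w.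
have Pall : forall w, P w.
  apply: (connect_closed conn (v := v)) => [|a b]; first by rewrite /P eqxx.
  rewrite /P => /orP[/eqP-> vb|va ab]; first by rewrite vb orbT.
  move: none; rewrite negb_exists => /forallP/(_ b); rewrite negb_exists => /forallP/(_ a).
  by rewrite va [adj b a]adj_sym ab /= negb_and !negbK.
by move=> w /negPf nwv; have := Pall w; rewrite /P nwv.
Qed.

(** The shift from [uz] to [uw] touches no edge at [v], so [v] stays dominating and connectedness is
    automatic. *)
Lemma maximizer_second v w : dominating v -> w != v -> (forall u, u != v -> x u <= x w) ->
  forall u z, u != v -> z != v -> adj u z -> u != w -> adj u w.
Proof.
move=> dom wv xmax u z uv zv uz uw; apply: contraT => nuw.
have [] := @maximizer_no_shift u z w uz nuw uw (xmax z zv).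
apply: (@dominating_connected _ (v : shift u z w)) => b bv.
rewrite /adj /= /shift_rel eq_sym bv (dom b bv) /ispair.
by rewrite ![v == _]eq_sym (negPf uv) (negPf zv).
Qed.

End Maximizer.

Section Equations.
Variables (R : realType) (al : R) (G : sgraph) (v : G) (x : G -> R).
Hypotheses (al_ge : 1 / 2 <= al) (al_lt1 : al < 1).
Hypotheses (dom : dominating v) (x_gt0 : forall a, 0 < x a) (xv : x v = 1).
Hypothesis xE : forall a, Aop al x a = Aalpha_radius al G * x a.
Hypothesis cG : (1 < #|G|)%N.

Let T := Aalpha_radius al G - al.
Let N := (#|G| - 1)%N.

Lemma dominating_linked : linked [set~ v] al T (1 - al) x.
Proof.
move=> u; rewrite in_setC1 => uv; rewrite /T mulrBl -xE /Aop (bigD1 v) /=; last by rewrite adj_sym dom.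
rewrite xv [\sum_(w | adj u w && _) _](eq_bigl (fun w => (w \in [set~ v]) && adj u w)).
  by ring.
by move=> w; rewrite in_setC1 andbC.
Qed.

Lemma dominating_row : T + al - al * N%:R = (1 - al) * \sum_(u in [set~ v]) x u.
Proof.
have := xE v; rewrite xv mulr1 /Aop xv (eq_bigl (mem [set~ v])) => [|w]; last first.
  rewrite inE in_setC1; have [->|/dom] := eqVneq w v; first by rewrite adj_irr.
  by [].
rewrite big_split /= sumr_const card_setC1 -mulr_sumr -(mulr_natr (al * 1)) -/N /T; lra.
Qed.

Lemma dominating_T_gt0 : 0 < T.
Proof.
have /card_gt0P[u uU] : (0 < #|[set~ v]|)%N by rewrite card_setC1; lia.
rewrite -(pmulr_lgt0 _ (x_gt0 u)) (dominating_linked uU).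
rewrite ltr_wpDr ?subr_gt0 // sumr_ge0 // => w _.
have al0 : 0 <= al by apply: le_trans al_ge; rewrite divr_ge0.
by rewrite addr_ge0 // mulr_ge0 ?(ltW (x_gt0 _)) // subr_ge0 ltW.
Qed.

Lemma dominating_T_gt : al * (N%:R - 1) < T.
Proof.
have : 0 < T + al - al * N%:R.
  rewrite dominating_row mulr_gt0 ?subr_gt0 //.
  have /card_gt0P[u uU] : (0 < #|[set~ v]|)%N by rewrite card_setC1; lia.
  rewrite (bigD1 u) //= ltr_wpDr // sumr_ge0 // => w _; exact/ltW.
by lra.
Qed.

End Equations.

Lemma perron_vector_at (R : realType) (al : R) (G : sgraph) (v : G) :
  al < 1 -> connected_graph G -> exists x : G -> R, [/\ forall u, 0 < x u, x v = 1
    & forall u, Aop al x u = Aalpha_radius al G * x u].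
Proof.
move=> al1 conn; have G0 : (0 < #|G|)%N by apply/card_gt0P; exists v.
have [x x0 xE] := perron_vector al1 G0 conn; exists (fun u => x u / x v).
split=> [u||u]; first by rewrite divr_gt0.
  by rewrite divff // gt_eqF.
rewrite mulrA -xE /Aop mulr_suml; apply: eq_bigr => w _; ring.
Qed.

(** The star may be degenerate: if nothing but [v] is adjacent to [w], the rest is edgeless and any
    [w] serves as centre; [w] may also be dominating. *)
Definition star_type (G : sgraph) (v w : G) :=
  [/\ dominating v, w != v
    & forall y z, y != v -> z != v -> adj y z -> y = w \/ z = w].

Definition tri_type (G : sgraph) (v p q r : G) :=
  [/\ dominating v, [/\ p != v, q != v & r != v], [/\ p != q, p != r & q != r],
     [/\ adj p q, adj p r & adj q r]
    & forall y z, y != v -> z != v -> adj y z ->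
        y \in [:: p; q; r] /\ z \in [:: p; q; r]].

Section StarValues.
Variables (R : realType) (al : R) (K : sgraph) (v w : K) (y : K -> R) (a : nat).
Hypotheses (al_ge : 1 / 2 <= al) (al_lt1 : al < 1).
Hypotheses (st : star_type v w) (y_gt0 : forall u, 0 < y u) (yv : y v = 1).
Hypothesis yE : forall u, Aop al y u = Aalpha_radius al K * y u.
Hypothesis cK : (2 < #|K|)%N.
Hypothesis (Ka : (\sum_(u in [set~ v]) ideg [set~ v] u = 2 * a)%N).
Hypothesis a_gt0 : (0 < a)%N.

Let T := Aalpha_radius al K - al.
Let U := [set~ v].
Let c := y w.

(* [c] is the value at the centre of the star and [l] the common value at its
   leaves. *)
Lemma star_values : exists2 l, 0 < l &
  [/\ forall u, u \in U -> adj w u -> y u = l,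
      T * c = (1 - al) + a%:R * (al * c + (1 - al) * l),
      T * l = (1 - al) + (al * l + (1 - al) * c)
    & T * \sum_(u in U) y u = (1 - al) * (#|K| - 1)%:R + a%:R * (c + l)].
Proof.
have [dom wv only] := st.
have cK1 : (1 < #|K|)%N by lia.
have lnk := dominating_linked dom yv yE.
have T_gt := dominating_T_gt al_ge al_lt1 dom y_gt0 yv yE cK1.
(* The leaf equation reads [(T - al) * y u = (1 - al) * (1 + c)], so this inequality makes all
   leaves equal. *)
have alT : al < T.
  apply: le_lt_trans T_gt; rewrite -[leLHS]mulr1 ler_wpM2l //; first by move: al_ge; lra.
  by rewrite lerBrDr -[1 + 1]/(2%:R) ler_nat; lia.
have wU : w \in U by rewrite in_setC1.
have nbr u z : u \in U -> u != w -> z \in U -> adj u z -> z = w.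
  by rewrite !in_setC1 => uv /eqP uw zv uz; case: (only u z uv zv uz).
have idegL u : u \in U -> u != w -> ideg U u = adj u w :> nat.
  move=> uU uw; rewrite /ideg (bigD1 w) //= big1 ?addn0 // => z /andP[zU /eqP zw].
  by case E: (adj u z) => //; case: zw; exact: nbr E.
have idegw : ideg U w = a.
  have S : (\sum_(u in U | u != w) ideg U u = ideg U w)%N.
    rewrite [RHS]/ideg [RHS](bigD1 w) //= adj_irr add0n; apply: eq_bigr => u /andP[uU uw].
    by rewrite idegL // adj_sym.
  by have := Ka; rewrite (bigD1 w) //= S addnn -mul2n => /eqP; rewrite eqn_pmul2l // => /eqP.
have leaf u : u \in U -> adj w u -> (T - al) * y u = (1 - al) + (1 - al) * c.
  move=> uU wu; rewrite mulrBl (lnk u uU) (big_pred1 w); first by rewrite -/c; ring.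
  move=> z; apply/andP/eqP => [[zU uz]|->]; last by rewrite wU adj_sym.
  by apply: nbr uz => //; apply: contraTneq wu => ->; rewrite adj_irr.
have [l0 l0U wl0] : exists2 l0, l0 \in U & adj w l0.
  by apply: ideg_gt0P; rewrite idegw.
have leafE u : u \in U -> adj w u -> y u = y l0.
  by move=> uU wu; apply: (mulfI (_ : T - al != 0)); rewrite ?leaf // subr_eq0 gt_eqF.
exists (y l0) => //; split=> //.
- rewrite (lnk w wU); congr (_ + _).
  rewrite -idegw idegE mulr_suml; apply: eq_bigr => u /andP[uU wu].
  by rewrite mul1r (leafE u).
- by have := leaf l0 l0U wl0; rewrite mulrBl; lra.
have -> : (#|K| - 1)%N = #|U| by rewrite card_setC1.
rewrite (linked_sum lnk); congr (_ + _).
have -> : a%:R * (c + y l0) = 2^-1 * \sum_(u in U) (ideg U u)%:R * (c + y l0).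
  by rewrite -mulr_suml -natr_sum Ka natrM mulrA mulKf ?pnatr_eq0.
congr (_ * _).
apply: eq_bigr => u uU; rewrite idegE mulr_suml; apply: eq_bigr => z /andP[zU uz].
rewrite mul1r; have [uw|uw] := eqVneq u w.
  by move: uz; rewrite uw => wz; rewrite (leafE z).
have zw := nbr u z uU uw zU uz; rewrite zw in uz *.
by rewrite (leafE u) 1?adj_sym // addrC.
Qed.

End StarValues.

Section StarCompare.
Variables (R : realType) (al : R) (G K : sgraph) (v : G) (v' w' : K) (a : nat).
Hypotheses (al_ge : 1 / 2 <= al) (al_lt1 : al < 1).
Hypotheses (dom : dominating v) (st : star_type v' w').
Hypotheses (cGK : #|G| = #|K|) (cG : (2 < #|G|)%N) (a_gt0 : (0 < a)%N).
Hypothesis Ga : (\sum_(u in [set~ v]) ideg [set~ v] u = 2 * a)%N.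
Hypothesis Ka : (\sum_(u in [set~ v']) ideg [set~ v'] u = 2 * a)%N.
Hypothesis KG : Aalpha_radius al K <= Aalpha_radius al G.

(** Because the radius of [G] is at least that of the star [K], the star values [c] and [c + l]
    remain a supersolution for [G]. With masses [X], [Y] off the dominating vertices this gives
    [T * X <= T' * Y], while the rows of [v] and [v'] give [Y <= X]; both must be equalities. *)
Lemma star_compare : Aalpha_radius al K = Aalpha_radius al G /\
  ((exists w, star_type v w) \/
   [/\ a = 3%N, al = 1 / 2 & exists p q r, tri_type v p q r]).
Proof.
have [dom' wv' _] := st.
have [x [x0 xv xE]] := perron_vector_at v al_lt1 (dominating_connected dom).
have [y [y0 yv yE]] := perron_vector_at v' al_lt1 (dominating_connected dom').
have cK : (2 < #|K|)%N by rewrite -cGK.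
have cG1 : (1 < #|G|)%N by lia.
have cK1 : (1 < #|K|)%N by lia.
have [l l0 [_ cE lE sE]] := star_values al_ge al_lt1 st y0 yv yE cK Ka a_gt0.
set T' := Aalpha_radius al K - al in cE lE sE; set c := y w' in cE lE sE.
have rowx := dominating_row dom xv xE; have rowy := dominating_row dom' yv yE.
have lnk := dominating_linked dom xv xE.
set T := Aalpha_radius al G - al in rowx lnk; rewrite -/T' -cGK in rowy.
have TT : T' <= T by rewrite /T' /T lerD2r.
have c0 : 0 < c by exact: y0.
have be0 : 0 < 1 - al by rewrite subr_gt0.
have cU : #|[set~ v]| = (#|G| - 1)%N by exact: card_setC1.
have Tc : T' * c <= T * c by rewrite ler_pM2r.
have TP : T' * (c + l) <= T * (c + l) by rewrite ler_pM2r // addr_gt0.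
have P0 : 0 < c + l by rewrite addr_gt0.
have gE : (2 * al - 1) * c + (1 - al) * (c + l) = al * c + (1 - al) * l by ring.
have CG : (1 - al) + a%:R * ((2 * al - 1) * c + (1 - al) * (c + l)) <= T * c.
  by rewrite gE -cE.
have PG : 2 * (1 - al) + (c + l) + (a%:R - 1) * ((2 * al - 1) * c + (1 - al) * (c + l))
    <= T * (c + l).
  by apply: le_trans TP; rewrite gE [leRHS]mulrDr cE lE; lra.
have := linked_sum_le al_ge al_lt1 be0 lnk Ga c0 P0 CG PG.
rewrite cU cGK -sE; set X := \sum_(u in _) x u in rowx *; set Y := \sum_(u in _) y u in rowy *.
move=> le.
have XY : Y <= X by rewrite -(ler_pM2l be0) -rowx -rowy; lra.
have Y0 : 0 < Y.
  by rewrite /Y (bigD1 w') ?in_setC1 //= ltr_wpDr // sumr_ge0 // => u _; exact: ltW.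
have T'0 : 0 < T' by exact: (dominating_T_gt0 al_ge al_lt1 dom' y0 yv yE cK1).
have T0 : 0 < T by exact: lt_le_trans T'0 TT.
have eqT : T' = T.
  apply/le_anti; rewrite TT /= -(ler_pM2r Y0).
  by apply: le_trans le; rewrite ler_pM2l.
have rad : Aalpha_radius al K = Aalpha_radius al G by move: eqT; rewrite /T /T'; lra.
split=> //.
have tot : (1 - al) * #|[set~ v]|%:R + a%:R * (c + l) <= T * X.
  by rewrite cU cGK -sE eqT ler_pM2l.
have [tight ext] := linked_sum_eq al_ge al_lt1 be0 lnk Ga c0 P0 CG PG tot.
have [[w wU only]|[a3 [p [q [r [[pU qU rU] ne [pq pr qr] only]]]]]] := star_or_triangle Ga ext a_gt0.
  left; exists w; split=> //; first by move: wU; rewrite in_setC1.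
  by move=> b d bv dv; apply: only; rewrite in_setC1.
right; split=> //; last first.
  exists p, q, r; split=> //; first by split; rewrite -in_setC1.
  by move=> b d bv dv; apply: only; rewrite in_setC1.
have [npq npr nqr] := ne.
have e1 := tight p q pU qU pq; have e2 := tight p r pU rU pr; have e3 := tight q r qU rU qr.
have [xp xq xr] : [/\ x p = (c + l) / 2, x q = (c + l) / 2 & x r = (c + l) / 2].
  by move: e1 e2 e3; split; lra.
have := lnk p pU; rewrite (bigD1 q) ?qU //= (bigD1 r) ?rU ?pr 1?eq_sym //= big1 ?addr0; last first.
  move=> z /andP[/andP[/andP[zU pz] zq] zr].
  have [_] := only _ _ pU zU pz; rewrite !inE (negPf zq) (negPf zr) !orbF => /eqP zp.
  by rewrite zp adj_irr in pz.
rewrite xp xq xr -eqT => TxE.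
(* The triangle row and the star equations with three leaves both evaluate [T * (c + l)]. Their
   agreement is [(2 * al - 1) * (c - l) = 0], and [c = l] contradicts the star equations. *)
have PgE : c + l = 2 * (al * c + (1 - al) * l).
  by move: cE lE TxE; rewrite a3; lra.
have [//|nal] := eqVneq al (1 / 2).
have cl : c = l.
  have : (2 * al - 1) * (c - l) = 0 by rewrite mulrBr; lra.
  move/eqP; rewrite mulf_eq0 subr_eq0 => /orP[/eqP e|/eqP e]; last by lra.
  by case/eqP: nal; lra.
by move: cE lE; rewrite a3 -cl; lra.
Qed.

End StarCompare.

(** * Two hubs *)

Section Hub.
Variables (G : sgraph) (U : {set G}) (w : G).
Hypothesis wU : w \in U.
Hypothesis hub : forall u z, u \in U -> z \in U -> adj u z -> u != w -> adj u w.

Definition inbr : {set G} := [set u in U | adj w u]%SET.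

Lemma inbrE u : (u \in inbr) = (u \in U) && adj w u.
Proof. by rewrite inE. Qed.

Lemma card_inbr : #|inbr| = ideg U w.
Proof.
rewrite -sum1_card /ideg (eq_bigl _ _ inbrE) big_mkcondr.
by apply: eq_bigr => u _; case: (adj w u).
Qed.

Lemma hub_row (R : nmodType) (f : G -> R) u : u \in inbr ->
  \sum_(z in U | adj u z) f z = f w + \sum_(z in inbr | adj u z) f z.
Proof.
rewrite inbrE => /andP[uU wu]; rewrite (bigD1 w) /=; last by rewrite wU adj_sym.
congr (_ + _); apply: eq_bigl => z; rewrite inbrE.
case zU: (z \in U) => //=; case uz: (adj u z); rewrite ?andbF //= andbT.
have [->|zw] := eqVneq z w; first by rewrite adj_irr.
by rewrite adj_sym (hub zU uU) // adj_sym.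
Qed.

Lemma hub_isolated u : u \in U -> u != w -> ~~ adj w u ->
  forall z, z \in U -> adj u z = false.
Proof.
move=> uU uw wu z zU; apply: contraNF wu => uz.
by rewrite adj_sym (hub uU zU).
Qed.

(** By the hub property, every edge inside [U] either contains [w] or joins two neighbours of
    [w]. *)
Lemma sum_ideg_hub :
  (\sum_(u in U) ideg U u = 2 * ideg U w + \sum_(u in inbr) ideg inbr u)%N.
Proof.
rewrite (bigD1 w) //= (bigID (adj w)) /= [X in (_ + (_ + X))%N]big1 ?addn0; last first.
  move=> u /andP[/andP[uU uw] wu]; rewrite /ideg big1 // => z zU.
  by rewrite (hub_isolated uU uw wu).
rewrite mul2n -addnn -addnA -{3}card_inbr -sum1_card -big_split /=; congr (_ + _)%N.
apply: eq_big => [u|u /andP[/andP[uU uw] wu]].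
  rewrite inbrE; case: (u \in U) => //=; case wu: (adj w u); rewrite ?andbF // andbT.
  by apply: contraTneq wu => ->; rewrite adj_irr.
have uD : u \in inbr by rewrite inbrE uU.
rewrite /ideg [LHS](bigID (adj u)) /= [X in (_ + X)%N]big1 ?addn0; last first.
  by move=> z /andP[_ /negPf->].
have := hub_row (fun z => nat_of_bool (adj u z) : nat) uD.
rewrite /= => ->; rewrite adj_sym wu; congr (1 + _)%N.
by rewrite big_mkcondr; apply: eq_bigr => z _; case: (adj u z).
Qed.

End Hub.

(** The graph [K_2] joined to one edge [pq] and isolated vertices, that is [S_{n,2n-2}]; for four
    vertices it is [K_4]. *)
Definition fan_type (G : sgraph) (v w p q : G) :=
  [/\ [/\ dominating v, dominating w & w != v],
      [/\ p != v, p != w, q != v & q != w], p != q, adj p q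
    & forall y z, y != v -> y != w -> z != v -> z != w -> adj y z ->
        y = p /\ z = q \/ y = q /\ z = p].

(** Two dominating vertices account for [2n - 3] edges, so exactly one edge avoids both. *)
Lemma fan_typeP n m (G : sgraph) (v w : G) : inH n m G -> m = (2 * n - 2)%N ->
  dominating v -> dominating w -> w != v -> exists p q, fan_type v w p q.
Proof.
move=> [cG eG _] mE dv dw wv.
have dG := darts_dominating dv; rewrite darts_edges eG cG mE in dG.
set U := [set~ v] in dG; have wU : w \in U by rewrite in_setC1.
have hub u z : u \in U -> z \in U -> adj u z -> u != w -> adj u w.
  by move=> _ _ _ /dw; rewrite adj_sym.
have := sum_ideg_hub wU hub; set D := inbr U w => sD.
have DE u : (u \in D) = (u != v) && (u != w).
  rewrite inbrE in_setC1; have [->|/dw->] := eqVneq u w; last by [].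
  by rewrite adj_irr.
have cD : #|D| = (#|G| - 2)%N.
  have -> : #|D| = #|U :\ w| by apply: eq_card => u; rewrite DE !inE andbC.
  by have := cardsD1 w U; rewrite wU card_setC1; lia.
have D2 : (\sum_(u in D) ideg D u = 2 * 1)%N.
  have n2 : (1 < n)%N by rewrite -cG (cardD1 v) (cardD1 w) !inE wv.
  by have := card_inbr U w; rewrite -/D cD cG; lia.
have [p pD [q qD pq]] : exists2 p, p \in D & exists2 q, q \in D & adj p q.
  have : (0 < \sum_(u in D) ideg D u)%N by rewrite D2.
  rewrite lt0n sum_nat_eq0 => /forallPn[p]; rewrite negb_imply => /andP[pD].
  by rewrite -lt0n => /ideg_gt0P[q qD pq]; exists p => //; exists q.
have npq : p != q by apply: contraTneq pq => ->; rewrite adj_irr.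
have deg1 u z z' : u \in D -> z \in D -> z' \in D -> adj u z -> adj u z' -> z = z'.
  move=> uD zD z'D uz uz'; apply/eqP; apply: contraT => zz'.
  have := ideg_le D2 uD; rewrite /ideg (bigD1 z) //= (bigD1 z') /=; last by rewrite z'D eq_sym.
  by rewrite uz uz'.
exists p, q; move: (pD) (qD); rewrite !DE => /andP[pv pw] /andP[qv qw].
split=> // y z yv yw zv zw yz.
have yD : y \in D by rewrite DE yv.
have zD : z \in D by rewrite DE zv.
have qp : adj q p by rewrite adj_sym.
have zy : adj z y by rewrite adj_sym.
have [_ /(_ _ y z yD zD yz)] := ideg_edge D2 pD qD pq.
have ip := ideg_gt0 qD pq; have iq := ideg_gt0 pD qp.
move=> /(_ (leq_add ip iq)) /or4P[]/eqP e; rewrite {}e in yz zy yD zD *.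
- by left; split=> //; apply: deg1 yz pq.
- by right; split=> //; apply: deg1 yz qp.
- by right; split=> //; apply: deg1 zy pq.
- by left; split=> //; apply: deg1 zy qp.
Qed.

Section FanBound.
Variables (R : realType) (al rho : R) (K : sgraph) (v w p q : K).
Hypotheses (al_lt1 : al < 1) (fan : fan_type v w p q).
Hypothesis rho_ge : Aalpha_radius al K <= rho.
Let N := (#|K| - 1)%N.
Let t := rho - 2 * al.
Hypothesis t_gt1 : 1 < t.

Lemma fan_bound : 2 * (1 - al) +
  2 * (1 - al) ^+ 2 * ((N%:R - 1 + 2 / (t - 1)) / t) <= rho - al + 1 - al * N%:R.
Proof.
have [[dv dw wv] [pv pw qv qw] npq pq only] := fan.
(* [l] and [o] solve the eigenvalue equations for [rho] at every vertex other than the hubs, so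
   [rho * nrm2 y - qform al y] reduces to the two equal hub rows. It is nonnegative because [rho]
   bounds the radius. *)
pose l : R := 2 * (1 - al) / (t - 1); pose o := 2 * (1 - al) / t.
pose y u : R := if (u == v) || (u == w) then 1 else if (u == p) || (u == q) then l else o.
have t0 : 0 < t by apply: lt_trans t_gt1.
have t10 : 0 < t - 1 by rewrite subr_gt0.
have yv : y v = 1 by rewrite /y eqxx.
have yw : y w = 1 by rewrite /y eqxx orbT.
have out u z : u != v -> u != w -> adj u z && (z != v) && (z != w) =
    (u == p) && (z == q) || (u == q) && (z == p).
  move=> uv uw; apply/andP/orP => [[/andP[uz zv] zw]|].
    by have [[-> ->]|[-> ->]] := only u z uv uw zv zw uz; rewrite !eqxx; auto.
  by case=> /andP[/eqP-> /eqP->]; rewrite ?pq ?[adj q p]adj_sym ?pq.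
have rowo u : u != v -> u != w -> Aop al y u = rho * y u.
  move=> uv uw; rewrite /Aop (bigD1 v) /=; last by rewrite adj_sym dv.
  rewrite (bigD1 w) /=; last by rewrite adj_sym dw.
  rewrite yv yw (eq_bigl _ _ (fun z => out u z uv uw)).
  have lE : (t - 1) * l = 2 * (1 - al) by rewrite mulrC divfK ?gt_eqF.
  have oE : t * o = 2 * (1 - al) by rewrite mulrC divfK ?gt_eqF.
  have yp : y p = l by rewrite /y (negPf pv) (negPf pw) eqxx.
  have yq : y q = l by rewrite /y (negPf qv) (negPf qw) eqxx orbT.
  have [->|up] := eqVneq u p.
    rewrite (big_pred1 q) => [|z]; last by rewrite (negPf npq) orbF.
    by rewrite yp yq; move: lE; rewrite /t; lra.
  have [->|uq] := eqVneq u q.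
    rewrite (big_pred1 p) => [|z]; last by [].
    by rewrite yp yq; move: lE; rewrite /t; lra.
  rewrite big_pred0 => [|z]; last by [].
  rewrite (_ : y u = o); last by rewrite /y (negPf uv) (negPf uw) (negPf up) (negPf uq).
  by move: oE; rewrite /t; lra.
have v0 : (0 < #|K|)%N by apply/card_gt0P; exists v.
pose S := \sum_(u | (u != v) && (u != w)) y u.
have rowd c d : dominating c -> d != c -> y c = 1 -> y d = 1 ->
    (forall u, ((u != c) && (u != d)) = ((u != v) && (u != w))) ->
    Aop al y c = al * N%:R + (1 - al) * (1 + S).
  move=> dc dc' yc yd cd; rewrite /Aop yc (eq_bigl (fun u => u != c)) => [|u]; last first.
    by have [->|/dc->] := eqVneq u c; rewrite ?adj_irr.
  rewrite big_split /= -!mulr_sumr; congr (_ * _ + _ * _); last first.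
    by rewrite (bigD1 d) //= yd (eq_bigl _ _ cd).
  rewrite sumr_const; congr (_%:R).
  by rewrite /N subn1 -(cardC1 c); apply: eq_card => u; rewrite !inE.
have SE : S = (N%:R - 1) * o + 2 * (l - o).
  have c2 : \sum_(u | (u != v) && (u != w)) o = (N%:R - 1) * o.
    rewrite sumr_const -(mulr_natl o); congr (_ * _).
    have -> : #|[pred u | (u != v) && (u != w)]| = #|[set~ v] :\ w|.
      by apply: eq_card => u; rewrite !inE andbC.
    by rewrite /N -(card_setC1 v) (cardsD1 w [set~ v]) in_setC1 wv natrD addrAC subrr add0r.
  have -> : S = \sum_(u | (u != v) && (u != w)) o +
      \sum_(u | (u != v) && (u != w)) (if (u == p) || (u == q) then l - o else 0).
    rewrite -big_split; apply: eq_bigr => u /andP[/negPf uv /negPf uw] /=.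
    by rewrite /y uv uw /=; case: ifP; lra.
  rewrite c2; congr (_ + _); rewrite -big_mkcondr (bigD1 p) /=; last by rewrite pv pw eqxx.
  rewrite (bigD1 q) /=; last by rewrite qv qw eqxx orbT eq_sym npq.
  rewrite big_pred0 ?addr0; first by lra.
  by move=> u; apply/negP => /andP[/andP[/andP[_ /orP[]->]]].
have := radius_ub al_lt1 v0 y.
have nle : Aalpha_radius al K * nrm2 y <= rho * nrm2 y by rewrite ler_wpM2r ?nrm2_ge0.
move=> /le_trans/(_ nle); rewrite -subr_ge0.
have -> : rho * nrm2 y - qform al y = 2 * (rho - (al * N%:R + (1 - al) * (1 + S))).
  rewrite /nrm2 /qform mulr_sumr -sumrB (bigD1 v) //= (bigD1 w) //= [X in _ + (_ + X)]big1.
    rewrite (rowd v w) // (rowd w v) // 1?eq_sym //; first by rewrite yv yw; lra.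
    by move=> u; rewrite andbC.
  by move=> u /andP[uv uw]; rewrite rowo //; ring.
rewrite pmulr_rge0 // subr_ge0 SE => H.
have -> : 2 * (1 - al) ^+ 2 * ((N%:R - 1 + 2 / (t - 1)) / t) =
   (1 - al) * ((N%:R - 1) * o + 2 * (l - o)).
  by rewrite /o /l; field; rewrite !gt_eqF.
by lra.
Qed.

End FanBound.

Section TwoHubs.
Variables (R : realType) (al : R) (n m : nat) (G K : sgraph) (v : G) (v' w' : K).
Hypotheses (al_ge : 1 / 2 <= al) (al_lt1 : al < 1) (mE : m = (2 * n - 2)%N).
Hypothesis maxG : maximizes_radius al n m G.
Hypotheses (inK : inH n m K) (dv' : dominating v') (dw' : dominating w') (wv' : w' != v').
Hypothesis dv : dominating v.

(** [w] is a vertex of largest entry off [v]. If it missed some vertex, the rows of [v] and [w]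
    together with the maximum principle on the neighbourhood [D] of [w] would contradict
    [two_hub_ineq]. *)
Lemma second_dominating : exists2 w, w != v & dominating w.
Proof.
have [[cG eG _] max] := maxG.
have [x [x0 xv xE]] := perron_vector_at v al_lt1 (dominating_connected dv).
have n2 : (1 < n)%N by case: inK => <- _ _; rewrite (cardD1 v') (cardD1 w') !inE wv'.
set U := [set~ v]; have cU : #|U| = (n - 1)%N by rewrite card_setC1 cG.
have [w0 w0U] : exists w0, w0 \in U by apply/card_gt0P; rewrite cU; lia.
case: (@arg_maxP _ _ _ w0 (mem U) x w0U) => w wU' xmax.
have wU : w \in U := wU'.
have wv : w != v by rewrite -in_setC1.
have hub u z : u \in U -> z \in U -> adj u z -> u != w -> adj u w.
  rewrite !in_setC1 => uv zv uz uw.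
  apply: (maximizer_second al_ge al_lt1 maxG x0 xE dv wv) uv zv uz uw => a av.
  have aU : a \in U by rewrite in_setC1.
  exact: xmax aU.
have cUw : #|U :\ w| = (n - 2)%N.
  by have := cardsD1 w U; rewrite wU cU; clear -n2; lia.
set D := inbr U w; pose Dl := #|D|.
have sU := darts_dominating dv; rewrite darts_edges eG cG -/U mE in sU.
have sD := sum_ideg_hub wU hub; rewrite -/D -card_inbr -/D -/Dl in sD.
have DU : (Dl <= n - 2)%N.
  have : (#|D| <= #|U :\ w|)%N.
    apply: subset_leq_card; apply/fintype.subsetP => u; rewrite inbrE !inE => /andP[-> wu].
    by rewrite andbT; apply: contraTneq wu => ->; rewrite adj_irr.
  by rewrite cUw.
have [DlE|DlN] := eqVneq Dl (n - 2)%N.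
  exists w => // u uw; have [->|uv] := eqVneq u v; first by rewrite adj_sym dv.
  have : D = U :\ w.
    apply/eqP; rewrite eqEcard; apply/andP; split.
      apply/fintype.subsetP => z; rewrite inbrE !inE => /andP[-> wz].
      by rewrite andbT; apply: contraTneq wz => ->; rewrite adj_irr.
    by rewrite cUw -/Dl DlE.
  by move=> /setP/(_ u); rewrite inbrE !inE uv uw /=.
(* [h] counts the vertices that [w] misses, all isolated after removal of [v]. Of the [n - 1] edges
   off [v], [Dl] contain [w], which leaves [h + 1] inside [D]. *)
pose h := (n - 2 - Dl)%N; have h1 : (1 <= h)%N by rewrite /h; lia.
have Db : (\sum_(u in D) ideg D u = 2 * (h + 1))%N by rewrite /h; lia.
(* At least two edges lie inside [D], and they need three vertices; this yields [h + 4 <= N]. *)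
have Dl3 : (3 <= Dl)%N.
  have : (\sum_(u in D) ideg D u <= \sum_(u in D) (Dl - 1))%N.
    apply: leq_sum => u uD; rewrite /ideg (bigD1 u) //= adj_irr add0n.
    have := cardsD1 u D; rewrite uD => cDu.
    apply: (@leq_trans (\sum_(i in D | i != u) 1)%N); first by apply: leq_sum => i _; case: (adj u i).
    have -> : (\sum_(i in D | i != u) 1 = #|D :\ u|)%N.
      by rewrite -sum1_card; apply: eq_bigl => i; rewrite in_setD1 andbC.
    by rewrite /Dl cDu add1n subn1.
  by rewrite Db sum_nat_const -/Dl; nia.
have [p' [q' fan]] := fan_typeP inK mE dv' dw' wv'.
pose N := (n - 1)%N; pose rho := Aalpha_radius al G.
pose T := rho - al; pose t := rho - 2 * al; pose be := 1 - al.
have cG2 : (1 < #|G|)%N by rewrite cG.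
have T_gt := dominating_T_gt al_ge al_lt1 dv x0 xv xE cG2.
have T0 := dominating_T_gt0 al_ge al_lt1 dv x0 xv xE cG2.
rewrite cG -/N -/rho -/T in T_gt; rewrite -/rho -/T in T0.
have NE : N%:R = Dl%:R + h%:R + 1 :> R by rewrite -!natrD natr1; congr (_%:R); rewrite /h /N; lia.
have h1R : 1 <= h%:R :> R by rewrite ler1n.
have Dl3R : 3 <= Dl%:R :> R by rewrite (ler_nat _ 3).
have t1 : 1 < t.
  have : al * 4 <= al * (N%:R - 1).
    by rewrite ler_wpM2l //; [move: al_ge; lra | rewrite NE; lra].
  by move: al_ge T_gt; rewrite /t /T; lra.
have rK : Aalpha_radius al K <= rho by apply: max.
have := fan_bound al_lt1 fan rK t1.
have -> : (#|K| - 1)%N = N by case: inK => ->.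
rewrite -/t -/be -/T => E_ge.
pose E := T + 1 - al * N%:R; pose s := t - 1 - al * h%:R.
have be0 : 0 < be by rewrite subr_gt0.
have albe : al + be = 1 by rewrite /be; ring.
have bele : be <= al by move: al_ge; rewrite /be; lra.
have hN : h%:R + 4 <= N%:R :> R by rewrite NE; lra.
have TE : T = t + al by rewrite /T /t; ring.
have s0 := two_hub_s_gt0 albe be0 bele h1R hN t1 TE (erefl E) (erefl s) E_ge.
pose F := E - h%:R * be ^+ 2 / T.
have ineq := two_hub_ineq albe be0 bele h1R hN t1 TE (erefl E) (erefl s) E_ge (erefl F).
have lnk := dominating_linked dv xv xE; rewrite -/rho -/T -/be in lnk.
pose X := x w; pose k2 := be * (1 + X).
have lnkD : linked D al t k2 x.
  move=> u uD; have uU : u \in U by move: uD; rewrite inbrE => /andP[].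
  have := lnk u uU; rewrite (hub_row wU hub _ uD) -/be -/X /t /T /k2 => e.
  by move: e; rewrite -/be -/X; lra.
have X0 : 0 < X by exact: x0.
have k20 : 0 < k2 by rewrite mulr_gt0 // addr_gt0.
(* The supersolution is taken with [C = P], so that [g = al * P]; this value of [P] turns the edge
   condition for [h + 1] edges into an equality. *)
pose P := 2 * k2 / s; have P0 : 0 < P by rewrite divr_gt0 // mulr_gt0.
have Ps : P * s = 2 * k2 by rewrite divfK // gt_eqF.
have gE : (2 * al - 1) * P + (1 - al) * P = al * P by ring.
have CP : k2 + (h + 1)%:R * ((2 * al - 1) * P + (1 - al) * P) <= t * P.
  have : 0 < be * P by rewrite mulr_gt0.
  by rewrite gE natrD; move: Ps; rewrite /s /be; lra.
have PP : 2 * k2 + P + ((h + 1)%:R - 1) * ((2 * al - 1) * P + (1 - al) * P) <= t * P.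
  by rewrite gE natrD; move: Ps; rewrite /s; lra.
have := linked_sum_le al_ge al_lt1 k20 lnkD Db P0 P0 CP PP.
pose SD := \sum_(u in D) x u; rewrite -/SD -/Dl => SDle.
have t0 : 0 < t by apply: lt_trans t1.
pose om := (N%:R - h%:R - 1 + 2 * (h%:R + 1) / s) / t.
have SDom : SD <= k2 * om.
  rewrite -(ler_pM2l t0); apply: le_trans SDle _.
  rewrite /om /P natrD NE le_eqVlt; apply/orP; left; apply/eqP.
  by field; rewrite !gt_eqF.
have rw : T * X = be + al * Dl%:R * X + be * SD.
  rewrite (lnk w wU) -/be -/X (eq_bigl (mem D)) => [|u]; last by rewrite -inbrE.
  by rewrite big_split /= sumr_const -mulr_sumr -/SD -(mulr_natr (al * X)) -/Dl; ring.
have ro u : u \in U -> u != w -> ~~ adj w u -> x u = be / T.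
  move=> uU uw wu; apply: (mulfI (lt0r_neq0 T0)); rewrite (lnk u uU) big_pred0 ?addr0.
    by rewrite mulrC divfK // gt_eqF.
  by move=> z; apply/negP => /andP[zU]; rewrite (hub_isolated hub uU uw wu zU).
have SU : \sum_(u in U) x u = X + SD + h%:R * (be / T).
  rewrite (bigD1 w) //= -addrA -/X; congr (_ + _); rewrite (bigID (adj w)) /=.
  congr (_ + _).
    apply: eq_bigl => u; rewrite inbrE; case: (u \in U) => //=.
    by case wu: (adj w u); rewrite ?andbF // andbT; apply: contraTneq wu => ->; rewrite adj_irr.
  rewrite (eq_bigr (fun=> be / T)) => [|u /andP[/andP[uU uw] wu]]; last exact: ro.
  rewrite sumr_const -(mulr_natl (be / T)); congr (_%:R * _).
  have -> : #|[pred u | (u \in U) && (u != w) && ~~ adj w u]| = #|(U :\ w) :\: D|.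
    apply: eq_card => u; rewrite inE finset.in_setD finset.in_setD1 inbrE.
    by case: (u \in U); case: (u == w); case: (adj w u).
  have sub : D \subset U :\ w.
    apply/fintype.subsetP => z; rewrite inbrE !inE => /andP[-> wz].
    by rewrite andbT; apply: contraTneq wz => ->; rewrite adj_irr.
  by rewrite cardsD (finset.setIidPr sub) cUw.
have rv := dominating_row dv xv xE; rewrite cG -/N -/rho -/T -/be -/U SU in rv.
(* The row of [v] gives [E] as [be] times the total mass, and each of the [h] missed vertices has
   entry [be / T]. The row of [w] then becomes [EX]. *)
have FE : F = be * (1 + X + SD).
  have hT : h%:R * be ^+ 2 / T = be * (h%:R * (be / T)) by field; rewrite gt_eqF.
  by rewrite /F hT /E; move: rv albe; lra.
have EX : (E + al * h%:R) * X = F.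
  by rewrite FE /E NE; move: rw; rewrite /be; lra.
exfalso; move: ineq; apply/negP; rewrite -leNgt.
have e1 : 0 < E + al * h%:R.
  have SD0 : 0 <= SD by apply: sumr_ge0 => u _; exact: ltW.
  by rewrite -(pmulr_lgt0 _ X0) EX FE mulr_gt0 // ltr_wpDr // addr_gt0.
have -> : F * (E + al * h%:R) = (E + al * h%:R) * (be * ((1 + X) + SD)) by rewrite FE; ring.
have -> : be * (E + al * h%:R + F) * (1 + be * om) = (E + al * h%:R) * (be * ((1 + X) + k2 * om)).
  by rewrite -EX /k2; ring.
by rewrite ler_pM2l // ler_pM2l // lerD2l.
Qed.

End TwoHubs.

(** * The extremal graphs *)

Local Open Scope nat_scope.

Lemma card_fibres (C : finType) (T : finType) (f : T -> C) :
  #|T| = \sum_c #|[pred x | f x == c]|.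
Proof.
rewrite -sum1_card (partition_big f xpredT) //=.
by apply: eq_bigr => c _; rewrite -sum1_card; apply: eq_bigl => x; rewrite inE.
Qed.

(* Since the class sizes add up to the order, one class may be ignored. *)
Lemma colour_iso_but (C : finType) (c0 : C) (M : rel C) (G H : sgraph)
    (f : G -> C) (g : H -> C) : #|G| = #|H| ->
  (forall x y : G, adj x y = (x != y) && M (f x) (f y)) ->
  (forall x y : H, adj x y = (x != y) && M (g x) (g y)) ->
  (forall c, c != c0 -> #|[pred x | f x == c]| = #|[pred y | g y == c]|) ->
  graph_iso G H.
Proof.
move=> cGH fE gE cE; apply: (colour_iso cGH fE gE) => c.
have [->|/cE //] := eqVneq c c0.
have := cGH; rewrite (card_fibres f) (card_fibres g) (bigD1 c0) //= [X in _ = X](bigD1 c0) //=.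
by rewrite (eq_bigr _ cE) => /addIn.
Qed.

(** A clique [D] joined to the disjoint union of a clique [Q] and isolated vertices. This covers
    both the fan, with sizes 2 and 2, and [Stilde], with sizes 1 and 3. *)
Definition clique_type (G : sgraph) (D Q : {set G}) :=
  (forall x, x \in D -> x \notin Q) /\
  forall x y, adj x y = (x != y) && [|| x \in D, y \in D | (x \in Q) && (y \in Q)].

Lemma clique_iso (G H : sgraph) (D Q : {set G}) (D' Q' : {set H}) :
  clique_type D Q -> clique_type D' Q' -> #|G| = #|H| -> #|D| = #|D'| -> #|Q| = #|Q'| ->
  graph_iso G H.
Proof.
move=> [dG aG] [dH aH] cGH cD cQ.
pose M (c d : bool * bool) := [|| c.1, d.1 | c.2 && d.2].
pose f x := (x \in D, x \in Q); pose g x := (x \in D', x \in Q').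
apply: (@colour_iso_but _ (false, false) M _ _ f g) => // -[[] []] _ //.
- rewrite !eq_card0 // => x; rewrite inE /=; apply/negP => /eqP[xD xQ].
    by have := dH _ xD; rewrite xQ.
  by have := dG _ xD; rewrite xQ.
- rewrite (eq_card (_ : _ =i D)) ?cD; last first.
    by move=> x; rewrite inE /f xpair_eqE; case E: (x \in D) => //=; rewrite (negPf (dG _ E)).
  apply: eq_card => x; rewrite inE /g xpair_eqE.
  by case E: (x \in D') => //=; rewrite (negPf (dH _ E)).
- rewrite (eq_card (_ : _ =i Q)) ?cQ; last first.
    move=> x; rewrite inE /f xpair_eqE; case E: (x \in D) => /=; last by case: (x \in Q).
    by rewrite (negPf (dG _ E)).
  apply: eq_card => x; rewrite inE /g xpair_eqE.
  case E: (x \in D') => /=; last by case: (x \in Q').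
  by rewrite (negPf (dH _ E)).
Qed.

Lemma fan_clique (G : sgraph) (v w p q : G) : fan_type v w p q ->
  clique_type [set v; w]%SET [set p; q]%SET.
Proof.
move=> [[dv dw wv] [pv pw qv qw] npq pq only]; split=> [x|x y].
  rewrite !inE => /orP[]/eqP->; rewrite negb_or ![_ == p]eq_sym ![_ == q]eq_sym.
    by rewrite pv.
  by rewrite pw.
have [->|xy] /= := eqVneq x y; first by rewrite adj_irr.
rewrite !inE; have [xv|xv] := eqVneq x v; first by rewrite xv dv // -xv eq_sym.
have [xw|xw] := eqVneq x w; first by rewrite xw dw // -xw eq_sym.
have [yv|yv] := eqVneq y v; first by rewrite yv adj_sym dv.
have [yw|yw] := eqVneq y w; first by rewrite yw adj_sym dw.
rewrite /=; apply/idP/andP => [xy'|[]].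
  by have [[-> ->]|[-> ->]] := only x y xv xw yv yw xy'; rewrite !eqxx !orbT.
move=> /orP[]/eqP ex /orP[]/eqP ey; move: xy; rewrite ex ey ?eqxx // => _.
by rewrite adj_sym.
Qed.

Lemma tri_clique (G : sgraph) (v p q r : G) : tri_type v p q r ->
  clique_type [set v]%SET [set p; q; r]%SET /\ #|[set p; q; r]%SET| = 3.
Proof.
move=> [dv [pv qv rv] [npq npr nqr] [pq pr qr] only].
split; last by rewrite -finset.setUA cardsU1 cards2 !inE negb_or npq npr nqr.
split=> [x|x y].
  by rewrite !inE => /eqP->; rewrite !negb_or ![v == _]eq_sym pv qv rv.
have [->|xy] /= := eqVneq x y; first by rewrite adj_irr.
rewrite !inE; have [xv|xv] := eqVneq x v; first by rewrite xv dv // -xv eq_sym.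
have [yv|yv] := eqVneq y v; first by rewrite yv adj_sym dv.
rewrite /=; apply/idP/andP => [xy'|[]].
  by have [] := only x y xv yv xy'; rewrite !inE -!orbA.
rewrite -!orbA => /or3P[]/eqP ex /or3P[]/eqP ey; move: xy; rewrite ex ey ?eqxx // => _;
  by rewrite adj_sym.
Qed.

Lemma star_hub (G : sgraph) (v w : G) : star_type v w -> let U := [set~ v]%SET in
  [/\ w \in U, forall u z, u \in U -> z \in U -> adj u z -> u != w -> adj u w
    & \sum_(u in U) ideg U u = 2 * #|inbr U w|].
Proof.
move=> [dv wv only] U.
have wU : w \in U by rewrite finset.in_setC1.
have nbr u z : u \in U -> z \in U -> adj u z -> u != w -> z = w.
  by rewrite !finset.in_setC1 => uv zv uz /eqP uw; case: (only u z uv zv uz).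
have hub u z : u \in U -> z \in U -> adj u z -> u != w -> adj u w.
  by move=> uU zU uz uw; rewrite -(nbr u z).
split=> //; rewrite (sum_ideg_hub wU hub) -card_inbr big1 ?addn0 // => u uD.
rewrite /ideg big1 // => z zD; case uz: (adj u z) => //.
move: uD zD; rewrite !inbrE => /andP[uU wu] /andP[zU wz].
have zw : z = w by apply: nbr uz _ => //; apply: contraTneq wu => ->; rewrite adj_irr.
by rewrite zw adj_irr in wz.
Qed.

(** The colours separate the dominating vertex, the centre, the leaves and the rest. The number of
    leaves is the edge count minus [n - 1], so order and size determine all classes. *)
Lemma star_iso (G H : sgraph) (v w : G) (v' w' : H) : star_type v w -> star_type v' w' ->
  #|G| = #|H| -> #|edges G| = #|edges H| -> graph_iso G H.
Proof.
move=> sG sH cGH eGH.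
pose M (c d : bool * bool * bool) :=
  [|| c.1.1, d.1.1, c.1.2 && d.2 | d.1.2 && c.2].
pose f (K : sgraph) (a b u : K) := (u == a, u == b, adj b u).
have adjE (K : sgraph) (a b : K) : star_type a b ->
    forall x y, adj x y = (x != y) && M (f K a b x) (f K a b y).
  move=> [da ba only] x y; have [->|xy] /= := eqVneq x y; first by rewrite adj_irr.
  rewrite /M /f /=; have [xa|xa] := eqVneq x a; first by rewrite xa da // -xa eq_sym.
  have [ya|ya] := eqVneq y a; first by rewrite ya adj_sym da.
  rewrite /=; apply/idP/orP => [xy'|].
    by have [xb|yb] := only x y xa ya xy'; [left | right];
       rewrite ?xb ?yb eqxx -?xb -?yb // adj_sym.
  by case=> /andP[/eqP-> //]; rewrite adj_sym.
have leaves (K : sgraph) (a b : K) : star_type a b ->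
    #|inbr [set~ a]%SET b| = #|edges K| - (#|K| - 1).
  move=> sK; have [dK _ _] := sK; have := darts_dominating dK.
  by rewrite darts_edges; have [_ _ ->] := star_hub sK; rewrite -mulnDr;
     move=> /eqP; rewrite eqn_pmul2l // => /eqP->; rewrite addKn.
have cnt (K : sgraph) (a b : K) : star_type a b -> forall c, c != (false, false, false) ->
    #|[pred u | f K a b u == c]| = if c == (true, false, true) then 1
      else if c == (false, true, false) then 1
      else if c == (false, false, true) then #|edges K| - (#|K| - 1) else 0.
  move=> sK c cn; have [da ba only] := sK.
  have ab : adj b a by rewrite adj_sym da.
  have fa : f K a b a = (true, false, true) by rewrite /f eqxx eq_sym (negPf ba) ab.
  have fb : f K a b b = (false, true, false) by rewrite /f eqxx (negPf ba) adj_irr.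
  have [->|c1] := eqVneq c (true, false, true).
    rewrite (eq_card (_ : _ =i pred1 a)) ?card1 // => u; rewrite !inE.
    by have [->|ua] := eqVneq u a; [rewrite fa eqxx | rewrite /f (negPf ua)].
  have [->|c2] := eqVneq c (false, true, false).
    rewrite (eq_card (_ : _ =i pred1 b)) ?card1 // => u; rewrite !inE.
    have [->|ub] := eqVneq u b; first by rewrite fb eqxx.
    by rewrite /f (negPf ub) !xpair_eqE andbF.
  have [->|c3] := eqVneq c (false, false, true).
    rewrite -(leaves _ _ _ sK); apply: eq_card => u; rewrite inbrE !inE /f !xpair_eqE.
    have [->|ub] := eqVneq u b; first by rewrite adj_irr !andbF.
    by case: (u == a); case: (adj b u).
  rewrite eq_card0 // => u; rewrite inE; apply/negP => /eqP fu.
  have [ua|ua] := eqVneq u a; first by rewrite -fu ua fa eqxx in c1.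
  have [ub|ub] := eqVneq u b; first by rewrite -fu ub fb eqxx in c2.
  by move: cn c3; rewrite -fu /f (negPf ua) (negPf ub); case: (adj b u).
apply: (@colour_iso_but _ (false, false, false) M _ _ (f G v w) (f H v' w')) => //.
- exact: adjE.
- exact: adjE.
by move=> c cn; rewrite !cnt // cGH eGH.
Qed.

(** * Recognition of [Sgraph] and [Stilde] *)

Definition Sg (k a r : nat) : sgraph :=
  gjoin (complete k) (gunion (star a) (edgeless r)).

Lemma Sg_card k a r : #|Sg k a r| = k + (1 + a + r).
Proof. by rewrite /Sg card_gjoin card_gunion card_gjoin !card_ord. Qed.

Lemma Sg_darts k a r : darts (Sg k a r) = k * (k - 1) + 2 * a + 2 * (k * (1 + a + r)).
Proof.
rewrite /Sg darts_gjoin darts_gunion darts_gjoin !darts_edgeless darts_complete.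
by rewrite card_gunion card_gjoin !card_ord; lia.
Qed.

Lemma Sg_dominating k a r (i : 'I_k) : @dominating (Sg k a r) (inl i).
Proof. by move=> [j|j] //=; rewrite /adj /= /complete_rel eq_sym. Qed.

Lemma inH_dominating n m (G : sgraph) (v : G) : dominating v ->
  #|G| = n -> darts G = 2 * m -> inH n m G.
Proof.
move=> dv cG dG; split=> //; last exact: dominating_connected dv.
by apply/eqP; rewrite -(eqn_pmul2l (isT : 0 < 2)) -darts_edges dG.
Qed.

Lemma Sg_inH k a r n m : 0 < k -> n = k + (1 + a + r) ->
  2 * m = k * (k - 1) + 2 * a + 2 * (k * (1 + a + r)) -> inH n m (Sg k a r).
Proof.
case: k => // k _ nE mE; apply: (@inH_dominating _ _ (Sg k.+1 a r) (inl ord0)).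
- exact: Sg_dominating.
- by rewrite Sg_card.
- by rewrite Sg_darts.
Qed.

Lemma Sg1_star a r : @star_type (Sg 1 a r) (inl ord0) (inr (inl (inl ord0))).
Proof.
split=> //; first exact: Sg_dominating.
move=> [i|[[i|i]|i]] [j|[[j|j]|j]] //=; rewrite ?(ord1 i) ?(ord1 j) //; auto.
Qed.

Lemma Sg2_star r : @star_type (Sg 2 0 r) (inl ord0) (inl ord_max).
Proof.
split=> //; first exact: Sg_dominating.
by move=> [[[|[|i]] Hi]|[[i|[]//]|i]] [[[|[|j]] Hj]|[[j|[]//]|j]] //= _ _ _;
  first [left; congr inl; exact: val_inj | right; congr inl; exact: val_inj].
Qed.

Lemma SsumS n k : Ssum n k.+1 = Ssum n k + (n - k.+1).
Proof. by rewrite /Ssum big_nat_recr. Qed.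

Lemma leq_Ssum n j k : j <= k -> Ssum n j <= Ssum n k.
Proof.
elim: k => [|k IH]; first by rewrite leqn0 => /eqP->.
rewrite leq_eqVlt => /orP[/eqP->//|/IH le].
by rewrite SsumS; apply: leq_trans le (leq_addr _ _).
Qed.

(** The guard [k.+1 < n] serves the cases in which the maximum sits at the end of its range, such as
    [n = 2], or [K_4] with [k = 3]. *)
Lemma Sk_eq n m k : k < n -> Ssum n k <= m -> (k.+1 < n -> m < Ssum n k.+1) -> Sk n m = k.
Proof.
move=> kn le lt; apply/eqP; rewrite eqn_leq; apply/andP; split; last first.
  exact: (@leq_bigmax_cond _ (fun k : 'I_n => Ssum n k <= m) (fun k => k) (Ordinal kn)).
apply/bigmax_leqP => j jm; rewrite leqNgt; apply/negP => kj.
have := lt (leq_ltn_trans kj (ltn_ord j)); rewrite ltnNge; apply/negP; rewrite negbK.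
exact: leq_trans (leq_Ssum n kj) jm.
Qed.

Lemma Ssum0 n : Ssum n 0 = 0.
Proof. by rewrite /Ssum big_geq. Qed.

Lemma Sgraph_star n m : 1 < n -> n - 1 <= m -> m < 2 * n - 2 ->
  inH n m (Sgraph n m) /\ exists v w : Sgraph n m, star_type v w.
Proof.
(* At [m = 2n - 3] the star is full and the definition passes to [k = 2], [a = 0]; this graph is
   still of star type, centred at the second dominating vertex. For [n = 2] the index 2 is out of
   range, so [k = 1]. *)
move=> n1 mge mlt; have [m3|m3] := boolP ((n == 2) || (m < 2 * n - 3)).
  have Sk1 : Sk n m = 1 by apply: Sk_eq; rewrite ?SsumS ?Ssum0; lia.
  have Sa1 : Sa n m = m - (n - 1) by rewrite /Sa Sk1 SsumS Ssum0.
  rewrite /Sgraph Sk1; split; first by apply: Sg_inH; rewrite ?Sa1; lia.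
  by exists (inl ord0), (inr (inl (inl ord0))); exact: Sg1_star.
have Sk2 : Sk n m = 2 by apply: Sk_eq; rewrite ?SsumS ?Ssum0; lia.
have Sa2 : Sa n m = 0 by rewrite /Sa Sk2 !SsumS Ssum0; lia.
rewrite /Sgraph Sk2 Sa2; split; first by apply: Sg_inH; lia.
by exists (inl ord0), (inl ord_max); exact: Sg2_star.
Qed.

Lemma Sgraph_fan n m : 3 < n -> m = 2 * n - 2 ->
  inH n m (Sgraph n m) /\
  exists v w : Sgraph n m, [/\ dominating v, dominating w & w != v].
Proof.
(* For [n = 4] the graph is [K_4], which the definition presents with [k = 3], [a = 0] instead of
   [k = 2], [a = 1]. *)
move=> n3 mE; have [n4|n4] := eqVneq n 4.
  have Sk3 : Sk n m = 3 by apply: Sk_eq; rewrite ?SsumS ?Ssum0; lia.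
  have Sa3 : Sa n m = 0 by rewrite /Sa Sk3 !SsumS Ssum0; lia.
  rewrite /Sgraph Sk3 Sa3; split; first by apply: Sg_inH; lia.
  by exists (inl ord0), (inl ord_max); split=> //; exact: Sg_dominating.
have Sk2 : Sk n m = 2 by apply: Sk_eq; rewrite ?SsumS ?Ssum0; lia.
have Sa2 : Sa n m = 1 by rewrite /Sa Sk2 !SsumS Ssum0; lia.
rewrite /Sgraph Sk2 Sa2; split; first by apply: Sg_inH; lia.
by exists (inl ord0), (inl ord_max); split=> //; exact: Sg_dominating.
Qed.

Lemma Stilde_dominating n : @dominating (Stilde n) (inl ord0).
Proof. by move=> [j|j] //=; rewrite (ord1 j). Qed.

Lemma Stilde_inH n : 3 < n -> inH n (n + 2) (Stilde n).
Proof.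
move=> n3; apply: (@inH_dominating _ _ (Stilde n) (inl ord0)).
- exact: Stilde_dominating.
- by rewrite card_gjoin card_gunion !card_ord; lia.
- rewrite darts_gjoin darts_gunion !darts_complete darts_edgeless card_gunion !card_ord; lia.
Qed.

Lemma Stilde_clique n : exists D Q : {set Stilde n},
  [/\ clique_type D Q, D = [set inl ord0]%SET & #|Q| = 3].
Proof.
exists [set inl ord0]%SET, [set (inr (inl i) : Stilde n) | i : 'I_3]%SET; split=> //; last first.
  by rewrite card_imset ?card_ord // => i j [].
have QE (x : Stilde n) : (x \in [set inr (inl i) | i : 'I_3]%SET) =
    if x is inr (inl _) then true else false.
  apply/imsetP/idP; first by case=> i _ ->.
  by case: x => [//|[i _|//]]; exists i.
split=> [x|x y]; first by rewrite inE QE => /eqP->.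
rewrite !QE !inE; case: x => [i|[i|i]]; case: y => [j|[j|j]] //=;
  rewrite ?(ord1 i) ?(ord1 j) ?eqxx ?andbF ?andbT //.
Qed.

Lemma darts_le (G : sgraph) : darts G <= #|G| * (#|G| - 1).
Proof.
rewrite /darts -sum_nat_const; apply: leq_sum => u _.
rewrite (bigD1 u) //= adj_irr add0n subn1 -(cardC1 u) -sum1_card.
by apply: leq_sum => w _; case: (adj u w).
Qed.

(** * The classification *)

Local Open Scope ring_scope.

Section StarTriangle.
Variables (R : realType) (al : R) (S G : sgraph) (v w : S) (u0 : G) (Q : {set G}).
Hypotheses (alE : al = 1 / 2) (st : star_type v w).
Hypotheses (cq : clique_type [set u0]%SET Q) (cQ : #|Q| = 3%N).
Hypotheses (cSG : #|S| = #|G|) (cS : (2 < #|S|)%N).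
Hypothesis (Sa : (\sum_(u in [set~ v]) ideg [set~ v] u = 2 * 3)%N).

(* At [al = 1/2] a star with three edges and a triangle have the same line
   graph: averaging the Perron values over the edges of the star gives an
   eigenvector on the triangle. *)
Lemma star_le_triangle : Aalpha_radius al S <= Aalpha_radius al G.
Proof.
have al_ge : 1 / 2 <= al by rewrite alE.
have al_lt1 : al < 1 by rewrite alE; lra.
have [dv wv _] := st.
have [y [y0 yv yE]] := perron_vector_at v al_lt1 (dominating_connected dv).
have [l _ [_ cE lE sE]] := star_values al_ge al_lt1 st y0 yv yE cS Sa isT.
have cS1 : (1 < #|S|)%N by apply: leq_trans cS.
have T0 := dominating_T_gt0 al_ge al_lt1 dv y0 yv yE cS1.
have row := dominating_row dv yv yE.
set rho := Aalpha_radius al S in cE lE sE T0 row *.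
pose T := rho - al; rewrite -/T in cE lE sE T0 row.
set c := y w in cE lE sE; rewrite cSG in sE row.
pose o := (1 - al) / T; have oE : T * o = 1 - al by rewrite mulrC divfK // gt_eqF.
pose x u : R := if u == u0 then 1 else if u \in Q then (c + l) / 2 else o.
have xu0 : x u0 = 1 by rewrite /x eqxx.
have [DQ adjE] := cq.
have u0Q : u0 \notin Q by apply: DQ; rewrite inE.
have adj0 u : adj u0 u = (u != u0).
  by rewrite adjE !inE eqxx eq_sym andbT.
apply: (@eigen_le_radius R al al_lt1 G x rho u0); first by rewrite xu0 oner_eq0.
have xQ u : u \in Q -> x u = (c + l) / 2.
  by move=> uQ; rewrite /x uQ; case: eqP => // e; rewrite -e uQ in u0Q.
move=> u; rewrite -/rho; have [->|uu0] := eqVneq u u0.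
  rewrite AopE xu0 !mulr1 (eq_bigl _ _ adj0).
  have -> : degree u0 = (#|G| - 1)%N.
    by rewrite degreeE subn1 -(cardC1 u0); apply: eq_card => u'; rewrite !inE -adj0.
  have -> : \sum_(u' | u' != u0) x u' = (#|G| - 1)%:R * o + 3 * ((c + l) / 2 - o).
    have e u' : u' != u0 -> x u' = o + (if u' \in Q then (c + l) / 2 - o else 0).
      by move=> /negPf u'0; rewrite /x u'0; case: ifP => _; ring.
    rewrite (eq_bigr _ e) big_split /= sumr_const -big_mkcondr; congr (_ + _).
      rewrite -(mulr_natl o); congr (_%:R * _).
      by rewrite subn1 -(cardC1 u0); apply: eq_card => u'; rewrite !inE.
    rewrite (eq_bigl (mem Q)) => [|u']; last first.
      by rewrite /=; case u'Q: (u' \in Q); rewrite ?andbF // andbT; apply: contraTneq u'Q => ->.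
    by rewrite sumr_const cQ -[LHS]mulr_natl.
  move: row sE; set Y := \sum_(u' in _) y u'; set N := (#|G| - 1)%:R => row sE.
  (* The row at [u0] sees only a total, and [x] has the same mass off [u0] as the star vector has
     off [v]. *)
  suff -> : N * o + 3 * ((c + l) / 2 - o) = Y by move: row; rewrite /T; lra.
  apply: (mulfI (lt0r_neq0 T0)); rewrite sE.
  have -> : T * (N * o + 3 * ((c + l) / 2 - o)) =
    N * (T * o) + 3 * ((T * c + T * l) / 2 - T * o) by ring.
  by rewrite oE cE lE alE; lra.
have adjU u' : adj u u' && (u' != u0) = (u \in Q) && ((u' \in Q) && (u' != u)).
  rewrite adjE !inE (negPf uu0) /= [u' == u]eq_sym; have [->|u'0] := eqVneq u' u0.
    by rewrite (negPf u0Q) !andbF.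
  by rewrite andbT; case: (u \in Q); case: (u' \in Q); case: (u == u').
rewrite /Aop (bigD1 u0) /=; last by rewrite adj_sym adj0.
rewrite xu0 (eq_bigl _ _ adjU); case uQ: (u \in Q); last first.
  rewrite /= big_pred0_eq addr0.
  by rewrite (_ : x u = o); [move: oE; rewrite /T; lra | rewrite /x (negPf uu0) uQ].
rewrite /= (eq_bigr (fun=> (c + l) / 2)) => [|u' /andP[u'Q _]]; last first.
  by rewrite (xQ u) // (xQ u') //; ring.
rewrite sumr_const (_ : #|_| = 2%N) ?(xQ u) //; last first.
  have := cardsD1 u Q; rewrite uQ cQ add1n => -[->].
  by apply: eq_card => u'; rewrite !inE andbC.
by rewrite -mulr_natl; move: cE lE; rewrite /T alE; lra.
Qed.

End StarTriangle.

Section Classification.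
Variables (R : realType) (al : R) (n m : nat).
Hypotheses (al_ge : 1 / 2 <= al) (al_lt1 : al < 1).
Hypotheses (n_gt0 : (0 < n)%N) (m_gt0 : (0 < m)%N).
Hypotheses (m_ge : (n - 1 <= m)%N) (m_le : (m <= 2 * n - 2)%N).

(** [2n - 2 <= n(n-1)/2] leaves only [n = 1] and [n >= 4]; the former would give [m = 0]. *)
Lemma inH_size G : inH n m G -> m = (2 * n - 2)%N -> (3 < n)%N.
Proof.
move=> [cG eG _] mE; have := darts_le G; rewrite darts_edges cG eG mE.
by case: n n_gt0 mE => [|[|[|[|k]]]] //; lia.
Qed.

Lemma maximizer_classification G : maximizes_radius al n m G ->
  [/\ inH n m (Sgraph n m), Aalpha_radius al (Sgraph n m) = Aalpha_radius al G
    & graph_iso G (Sgraph n m) \/ [/\ m = (n + 2)%N, al = 1 / 2 & graph_iso G (Stilde n)]].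
Proof.
move=> maxG; have [inG max] := maxG; have [cG eG coG] := inG.
have G0 : (0 < #|G|)%N by rewrite cG.
(* Equality of the radii needs an argument only in the triangle case; otherwise it follows from the
   isomorphism. *)
suff : inH n m (Sgraph n m) /\ (graph_iso G (Sgraph n m) \/
    [/\ Aalpha_radius al (Sgraph n m) = Aalpha_radius al G,
        m = (n + 2)%N, al = 1 / 2 & graph_iso G (Stilde n)]).
  move=> [inS [iso|[rE mE aE iso]]]; split=> //; [|by left|by right].
  by rewrite (iso_radius al_lt1 G0 iso).
have n2 : (1 < n)%N by lia.
have [x x0 xE] := perron_vector al_lt1 G0 coG.
have /card_gt0P[v0 _] := G0.
case: (@arg_maxP _ _ _ v0 xpredT x isT) => v _ xmax.
have dv : dominating v.
  by apply: (maximizer_dominating al_ge al_lt1 maxG x0 xE) => w; exact: xmax.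
have [mE|mN] := eqVneq m (2 * n - 2)%N.
  have n3 := inH_size inG mE.
  have [inS [v' [w' [dv' dw' wv']]]] := Sgraph_fan n3 mE; split=> //; left.
  have [w wv dw] := second_dominating al_ge al_lt1 mE maxG inS dv' dw' wv' dv.
  have [p [q fG]] := fan_typeP inG mE dv dw wv.
  have [p' [q' fS]] := fan_typeP inS mE dv' dw' wv'.
  apply: (clique_iso (fan_clique fG) (fan_clique fS)).
  - by case: inS => ->.
  - by rewrite !cards2 ![_ == v]eq_sym ![_ == v']eq_sym in wv wv' *; rewrite wv wv'.
  - by case: fG => _ _ npq _ _; case: fS => _ _ npq' _ _; rewrite !cards2 npq npq'.
have mlt : (m < 2 * n - 2)%N by lia.
have [inS [v' [w' st]]] := Sgraph_star n2 m_ge mlt; split=> //.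
have [cS eS _] := inS; have [dv' _ _] := st.
have cGS : #|G| = #|Sgraph n m| by rewrite cG cS.
have eGS : #|edges G| = #|edges (Sgraph n m)| by rewrite eG eS.
pose a := (m - (n - 1))%N.
have degs (K : sgraph) (u : K) : #|K| = n -> #|edges K| = m -> dominating u ->
    (\sum_(z in [set~ u]) ideg [set~ u] z = 2 * a)%N.
  by move=> cK eK /darts_dominating; rewrite darts_edges cK eK /a; lia.
have Ga := degs G v cG eG dv; have Ka := degs _ v' cS eS dv'.
(* With [a = 0] nothing is left off [v], so [G] is itself a star and any other vertex can play the
   degenerate centre. *)
have [a0|a0] := posnP a.
  left; have [w wv] : exists w, w \in [set~ v] by apply/card_gt0P; rewrite card_setC1 cG; lia.
  apply: (@star_iso _ _ v w v' w') => //; split=> //; first by rewrite -finset.in_setC1.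
  move=> y z; rewrite -!finset.in_setC1 => yU zU yz.
  by have := leq_trans (ideg_gt0 zU yz) (ideg_le Ga yU); rewrite a0.
have cG2 : (2 < #|G|)%N by rewrite cG; move: a0 mlt; rewrite /a; lia.
have [rE [[w sG]|[a3 aE [p [q [r tG]]]]]] :=
  star_compare al_ge al_lt1 dv st cGS cG2 a0 Ga Ka (max _ inS).
  by left; exact: star_iso sG st cGS eGS.
have n5 : (3 < n)%N by move: a3; rewrite /a; lia.
right; split=> //; first by move: a3; rewrite /a; lia.
have [cl c3] := tri_clique tG; have [D [Q [clS DE cQ]]] := Stilde_clique n.
have [cSt _ _] := Stilde_inH n5.
by apply: (clique_iso cl clS); rewrite ?c3 ?cQ ?DE ?cards1 // cG cSt.
Qed.

End Classification.

Theorem theorem4p1 (R : realType) (n m : nat) (alpha : R)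
    (n_gt0 : (0 < n)%N) (m_gt0 : (0 < m)%N)
    (m_ge : (n - 1 <= m)%N) (m_le : (m <= 2 * n - 2)%N) :
  ((1 / 2 < alpha /\ alpha < 1) \/ (alpha = 1 / 2 /\ m <> (n + 2)%N) ->
     (exists G : sgraph, inH n m G) ->
     forall G : sgraph,
       maximizes_radius alpha n m G <-> graph_iso G (Sgraph n m)) /\
  (m = (n + 2)%N -> alpha = 1 / 2 ->
     forall G : sgraph,
       maximizes_radius alpha n m G <->
         graph_iso G (Sgraph n (n + 2)) \/ graph_iso G (Stilde n)).
Proof.
split=> [hyp exG G|mE alE G].
  have al_ge : 1 / 2 <= alpha by case: hyp => [[/ltW]|[->]].
  have al_lt1 : alpha < 1 by case: hyp => [[]|[-> _]] //; lra.
  have classify := maximizer_classification al_ge al_lt1 n_gt0 m_gt0 m_ge m_le.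
  have key H : maximizes_radius alpha n m H -> graph_iso H (Sgraph n m).
    move=> /classify[_ _ [//|[mE alE _]]].
    by case: hyp => [[]|[_ /(_ mE)]] //; rewrite alE ltxx.
  split=> [/key//|isoG].
  (* The classification only says what a maximiser must be; existence of one makes [Sgraph] itself a
     maximiser. *)
  have [G0 maxG0] := maximizer_exists al_lt1 n_gt0 exG.
  exact: (iso_maximizes al_lt1 n_gt0 (graph_iso_trans (key _ maxG0) (graph_iso_sym isoG))).
have al_ge : 1 / 2 <= alpha by rewrite alE.
have al_lt1 : alpha < 1 by rewrite alE; lra.
have classify := maximizer_classification al_ge al_lt1 n_gt0 m_gt0 m_ge m_le.
have n3 : (3 < n)%N by lia.
have inSt := Stilde_inH n3; rewrite -mE in inSt *.
split=> [/classify[_ _ [iso|[_ _ iso]]]|]; [by left | by right |].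
have [G0 maxG0] := maximizer_exists al_lt1 n_gt0 (ex_intro _ _ inSt).
have [inS rE _] := classify _ maxG0.
have maxS : maximizes_radius alpha n m (Sgraph n m).
  by split=> // H inH'; rewrite rE; case: maxG0 => _; apply.
case=> iso; first exact: (iso_maximizes al_lt1 n_gt0 (graph_iso_sym iso) maxS).
apply: (iso_maximizes al_lt1 n_gt0 (graph_iso_sym iso)).
have [D [Q [clS DE cQ]]] := Stilde_clique n; rewrite DE in clS.
have [cSt eSt _] := inSt; have [cS eS _] := inS.
(* For [n = 4] one has [n + 2 = 2n - 2], outside the star range, but both graphs are then [K_4]. For
   larger [n] the star of [Sgraph] has three edges and its radius is at most that of [Stilde]. *)
have [n4|n4] := eqVneq n 4.
  have mE2 : m = (2 * n - 2)%N by lia.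
  have [_ [v' [w' [dv' dw' wv']]]] := Sgraph_fan n3 mE2.
  have [p' [q' fS]] := fan_typeP inS mE2 dv' dw' wv'.
  have dw : @dominating (Stilde n) (inr (inl ord0)).
    by rewrite n4 => -[j|[j|[]]] //=; rewrite /adj /= /complete_rel eq_sym.
  have dv := @Stilde_dominating n.
  have [p [q fSt]] := fan_typeP inSt mE2 dv dw isT.
  have isoS : graph_iso (Sgraph n m) (Stilde n).
    apply: (clique_iso (fan_clique fS) (fan_clique fSt)); first by rewrite cS cSt.
    - by rewrite !cards2 eq_sym wv'.
    - by case: fS => _ _ npq _ _; case: fSt => _ _ npq' _ _; rewrite !cards2 npq npq'.
  exact: (iso_maximizes al_lt1 n_gt0 isoS maxS).
have n5 : (4 < n)%N by lia.
have mlt : (m < 2 * n - 2)%N by lia.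
have [_ [v' [w' st]]] := Sgraph_star (ltnW (ltnW n3)) m_ge mlt.
split=> // H inH'; case: maxS => _ /(_ H inH')/le_trans; apply.
apply: (star_le_triangle alE st clS cQ); rewrite ?cS ?cSt //; first by lia.
have [dv' _ _] := st; have := darts_dominating dv'; rewrite darts_edges cS eS; lia.
Qed.
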